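(* For every $n\geq 5$ there is a smooth quartic hypersurface $H^n\subset\mathbb P^{n+1}$ over $\mathbb Q(t)$ such that $H^n$ is unirational over $\mathbb Q(t)$ and $H^n$ has infinitely many R-equivalence classes, i.e. the set $H^n(\mathbb Q(t))/R$ is infinite.
   Context: R-equivalence: for a proper scheme $X$ over a field $F$, two points $x_1,x_2\in X(F)$ are directly R-equivalent if there is an $F$-morphism $p:\mathbb P^1\to X$ with $p(0{:}1)=x_1$ and $p(1{:}0)=x_2$. The equivalence relation generated by this is called R-equivalence, and $X(F)/R$ is the set of equivalence classes. A variety of dimension $n$ over $F$ is unirational over $F$ if there is a dominant rational map, defined over $F$, from a projective space over $F$ to it. *)

(* Defs.v *)
From Stdlib Require Export Relation_Operators.
From mathcomp Require Export all_boot all_order all_algebra.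
From mathcomp Require Export boolp classical_sets cardinality.
From mathcomp Require Export mpoly.

Set Implicit Arguments.
Unset Strict Implicit.
Unset Printing Implicit Defensive.

Import GRing.Theory.

Local Open Scope ring_scope.

(* A projective hypersurface in P^(k-1) over F is given by its equation
   f : {mpoly F[k]}, a form in k homogeneous coordinates.  Geometric conditions
   are tested at points with coordinates in arbitrary field extensions
   iota : F -> L, i.e. at all scheme-theoretic points. *)

Definition is_hypersurface (F : fieldType) (k d : nat) (f : {mpoly F[k]}) :=
  f != 0 /\ f \is d.-homog.

(* Homogeneous coordinates of the point of P^(k-1)(L) x lie on f = 0. *)
Definition vanishes_at (F L : fieldType) (iota : {rmorphism F -> L}) (k : nat)
    (f : {mpoly F[k]}) (x : 'rV[L]_k) :=
  (map_mpoly iota f).@[x 0] = 0.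

Definition smooth_hypersurface (F : fieldType) (k : nat) (f : {mpoly F[k]}) :=
  forall (L : fieldType) (iota : {rmorphism F -> L}) (x : 'rV[L]_k),
    x != 0 -> vanishes_at iota f x ->
    exists i : 'I_k, ~ vanishes_at iota f^`M(i) x.

(* The k-tuple g = (g_1 : ... : g_k) evaluated at coordinates y in an extension
   of F; the result is a point of P^(k-1) exactly when it is nonzero. *)
Definition eval_forms (F L : fieldType) (iota : {rmorphism F -> L}) (k l : nat)
    (g : k.-tuple {mpoly F[l]}) (y : 'rV[L]_l) : 'rV[L]_k :=
  \row_i (map_mpoly iota (tnth g i)).@[y 0].

Definition forms_of_degree (F : fieldType) (k l d : nat)
    (g : k.-tuple {mpoly F[l]}) :=
  forall i : 'I_k, tnth g i \is d.-homog.

(* g represents a rational map from P^(l-1) to the hypersurface f = 0. *)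
Definition is_rational_map_to (F : fieldType) (k l : nat) (f : {mpoly F[k]})
    (g : k.-tuple {mpoly F[l]}) :=
  [/\ exists d : nat, forms_of_degree d g,
      exists i : 'I_k, tnth g i != 0
    & f \mPo g = 0].

(* The image of g is dense in f = 0: a closed subset of P^(k-1) containing the
   image contains the hypersurface.  Closed subsets are intersections of zero
   loci of forms h, so it suffices to range over single forms. *)
Definition is_dominant_to (F : fieldType) (k l : nat) (f : {mpoly F[k]})
    (g : k.-tuple {mpoly F[l]}) :=
  forall (e : nat) (h : {mpoly F[k]}), h \is e.-homog ->
    (forall (L : fieldType) (iota : {rmorphism F -> L}) (y : 'rV[L]_l),
       eval_forms iota g y != 0 -> vanishes_at iota h (eval_forms iota g y)) ->
    forall (L : fieldType) (iota : {rmorphism F -> L}) (x : 'rV[L]_k),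
      x != 0 -> vanishes_at iota f x -> vanishes_at iota h x.

Definition unirational_hypersurface (F : fieldType) (k : nat)
    (f : {mpoly F[k]}) :=
  exists (m : nat) (g : k.-tuple {mpoly F[m.+1]}),
    is_rational_map_to f g /\ is_dominant_to f g.

(* A morphism from P^1 to f = 0: forms of one degree in two variables without
   common zero over any extension of F (i.e. without common factor). *)
Definition is_P1_morphism_to (F : fieldType) (k : nat) (f : {mpoly F[k]})
    (p : k.-tuple {mpoly F[2]}) :=
  [/\ exists d : nat, forms_of_degree d p,
      forall (L : fieldType) (iota : {rmorphism F -> L}) (y : 'rV[L]_2),
        y != 0 -> eval_forms iota p y != 0
    & f \mPo p = 0].

(* The image in P^(k-1)(F) of the point of P^1(F) with coordinates y; points of
   P^(k-1)(F) are the lines of the vector space F^k. *)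
Definition P1_image (F : fieldType) (k : nat) (p : k.-tuple {mpoly F[2]})
    (y : 'rV[F]_2) : {vspace 'rV[F]_k} :=
  <[ eval_forms (idfun : {rmorphism F -> F}) p y ]>%VS.

Definition rational_points (F : fieldType) (k : nat) (f : {mpoly F[k]}) :
    set {vspace 'rV[F]_k} :=
  [set P | (\dim P)%VS = 1%N /\ forall v : 'rV[F]_k, v \in P -> f.@[v 0] = 0]%classic.

(* delta_mx 0 1 = (0, 1) and delta_mx 0 0 = (1, 0). *)
Definition directly_R_equivalent (F : fieldType) (k : nat) (f : {mpoly F[k]})
    (P1 P2 : {vspace 'rV[F]_k}) : Prop :=
  exists p : k.-tuple {mpoly F[2]},
    [/\ is_P1_morphism_to f p,
        P1_image p (delta_mx 0 1) = P1
      & P1_image p (delta_mx 0 0) = P2].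

Definition R_equivalent (F : fieldType) (k : nat) (f : {mpoly F[k]}) :
    {vspace 'rV[F]_k} -> {vspace 'rV[F]_k} -> Prop :=
  clos_refl_sym_trans _ (directly_R_equivalent f).

Definition R_classes (F : fieldType) (k : nat) (f : {mpoly F[k]}) :
    set (set {vspace 'rV[F]_k}) :=
  [set C | exists2 P, rational_points f P &
           C = [set Q | rational_points f Q /\ R_equivalent f P Q]]%classic.

(* The field Q(t). *)
Definition Qt : fieldType := {fraction {poly rat}}.

(* Main.v *)
(* In the coordinates (a : x1 : x2 : x3 : b : e : g : tail) put
   q = x1^2 + 3 x2^2 + x3^2 - t^2 a^2, q1 = e^2 - a^2 - 5 b^2 and
   q2 = g^2 - a^2 + 5 b^2.  The quartic is
   f = q^2 + (1 - t)(q1^2 + q2^2) + t f1 + the fourth powers of the tail.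

   Infinitely many classes: at t = 0 this is a sum of squares, so its rational
   points are those of the genus one curve q1 = q2 = 0 in P^3, which admits no
   nonconstant map from P^1.  A map from P^1 to the generic fibre degenerates at
   t = 0, along the edges of its Newton polygon, to a chain of maps from P^1 to
   the special fibre; these are constant, so the specialization of a point
   depends only on its R-class.  Infinitely many points of the curve lift.

   Smoothness: at a place over t = 1 a singular point would specialize to a
   singular point of the fibre at t = 1 in characteristic zero.

   Unirationality: f restricts to q^2 on the 3-space b = tail = 0, e = g = a, and
   the rational surface q = 0 lies on f = 0.  The directions v of the lines with
   triple contact at a point z of this surface form a quadric in the tangent
   space of f = 0 at z, with a rational point given by the ruling of q = 0; so
   these lines are parametrized, and sending such a line to its fourth
   intersection point is a rational map to f = 0.  It is dominant: the Jacobian at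
   one point with t = 1 shows that the coordinates other than x3 of the image are
   algebraically independent, and f is irreducible of degree four in x3. *)

From HB Require Import structures.
From mathcomp Require Import fraction generic_quotient zify ring lra.
Require Import Defs.

Set Implicit Arguments.
Unset Strict Implicit.
Unset Printing Implicit Defensive.

Import Order.TTheory GRing.Theory Num.Theory.

Local Open Scope ring_scope.

(** * The family of quartics and its parametrization *)

(** Where the terms of f1 = e^4 + g^4 - 2 a^4 - 50 b^4 + b x1^3 + 32 (g - e) x2^3 come from: all of
    f1 vanishes when b = 0 and e = g = a. On q1 = q2 = 0 its first four terms cancel, since e^4 +
    g^4 = (a^2 + 5 b^2)^2 + (a^2 - 5 b^2)^2; so each rational point of the genus one curve lifts to
    (a : 0 : 0 : t a : b : e : g). There are infinitely many of them, 5 being a congruent number.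
    The term b x1^3 lets the tangency condition be solved for the b-coordinate of a direction, and
    the last two terms keep the ruling from being orthogonal, for the second order contact form, to
    every other tangent direction. The fibre at t = 0 is singular along that curve, so smoothness
    and dominance are read off at t = 1, where the factor 1 - t removes q1 and q2. The
    parametrization has degree 82 and is never expanded: its derivative is computed along a locus
    where it is a coordinate projection up to a common factor. *)

Section QuarticFamily.
Variables (A : comNzRingType) (m : nat) (t : A).
Implicit Types x z v w : nat -> A.

Definition quad0 x := x 1%N ^+ 2 + 3 * x 2%N ^+ 2 + x 3%N ^+ 2 - t ^+ 2 * x 0%N ^+ 2.
Definition quad1 x := x 5%N ^+ 2 - x 0%N ^+ 2 - 5 * x 4%N ^+ 2.
Definition quad2 x := x 6%N ^+ 2 - x 0%N ^+ 2 + 5 * x 4%N ^+ 2.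
Definition tail4 x := \sum_(i < m) x (7 + i)%N ^+ 4.

Definition residual x :=
  (1 - t) * (quad1 x ^+ 2 + quad2 x ^+ 2)
  + t * (x 5%N ^+ 4 + x 6%N ^+ 4 - 2 * x 0%N ^+ 4 - 50 * x 4%N ^+ 4
         + x 4%N * x 1%N ^+ 3 + 32 * (x 6%N - x 5%N) * x 2%N ^+ 3)
  + tail4 x.

Definition quartic x := quad0 x ^+ 2 + residual x.

(** The partial derivatives in closed form, as [derivation_quartic] confirms; the default of [nth]
    serves the tail. A formula over any ring can be reduced at a place. *)
Definition gradient (x : nat -> A) (i : nat) : A := nth (4 * x i ^+ 3)
  [:: - 4 * t ^+ 2 * x 0%N * quad0 x - 4 * (1 - t) * x 0%N * (quad1 x + quad2 x)
        - 8 * t * x 0%N ^+ 3;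
      4 * x 1%N * quad0 x + 3 * t * x 4%N * x 1%N ^+ 2;
      12 * x 2%N * quad0 x + 96 * t * (x 6%N - x 5%N) * x 2%N ^+ 2;
      4 * x 3%N * quad0 x;
      20 * (1 - t) * x 4%N * (quad2 x - quad1 x) + t * (x 1%N ^+ 3 - 200 * x 4%N ^+ 3);
      4 * (1 - t) * x 5%N * quad1 x + t * (4 * x 5%N ^+ 3 - 32 * x 2%N ^+ 3);
      4 * (1 - t) * x 6%N * quad2 x + t * (4 * x 6%N ^+ 3 + 32 * x 2%N ^+ 3)] i.

(* The 3-space b = tail = 0, e = g = a, on which the quartic is quad0 ^+ 2. *)
Definition lift3 z : nat -> A :=
  nth 0 [:: z 0%N; z 1%N; z 2%N; z 3%N; 0; z 0%N; z 0%N].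

Definition polar0 z v :=
  z 1%N * v 1%N + 3 * z 2%N * v 2%N + z 3%N * v 3%N - t ^+ 2 * z 0%N * v 0%N.

(* contact1, contact2, contact3 and quartic v are the coefficients of
   [quartic (lift3 z + s v)] in s, when quad0 z = 0. *)
Definition contact1 z v :=
  t * (z 1%N ^+ 3 * v 4%N + 4 * z 0%N ^+ 3 * (v 5%N + v 6%N - 2 * v 0%N)
       + 32 * z 2%N ^+ 3 * (v 6%N - v 5%N)).

Definition contact2 z v :=
  4 * polar0 z v ^+ 2
  + z 0%N ^+ 2 * (4 * (1 - t) * ((v 5%N - v 0%N) ^+ 2 + (v 6%N - v 0%N) ^+ 2)
                  + 6 * t * (v 5%N ^+ 2 + v 6%N ^+ 2 - 2 * v 0%N ^+ 2))
  + 3 * t * z 1%N ^+ 2 * v 4%N * v 1%N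
  + 96 * t * z 2%N ^+ 2 * (v 6%N - v 5%N) * v 2%N.

Definition contact3 z v :=
  4 * polar0 z v * quad0 v
  + 4 * (1 - t) * z 0%N * ((v 5%N - v 0%N) * quad1 v + (v 6%N - v 0%N) * quad2 v)
  + t * (4 * z 0%N * (v 5%N ^+ 3 + v 6%N ^+ 3 - 2 * v 0%N ^+ 3)
         + 3 * z 1%N * v 4%N * v 1%N ^+ 2
         + 96 * z 2%N * (v 6%N - v 5%N) * v 2%N ^+ 2).

Lemma tail4_lift3D z v (l k : A) :
  tail4 (fun i => l * lift3 z i + k * v i) = k ^+ 4 * tail4 v.
Proof.
rewrite /tail4 mulr_sumr; apply: eq_bigr => i _.
by rewrite /lift3 nth_default ?leq_addr // mulr0 add0r exprMn.
Qed.

Lemma quartic_chord z v (l k : A) : quad0 z = 0 ->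
  quartic (fun i => l * lift3 z i + k * v i) =
  l ^+ 3 * k * contact1 z v + l ^+ 2 * k ^+ 2 * contact2 z v
  + l * k ^+ 3 * contact3 z v + k ^+ 4 * quartic v.
Proof.
move=> qz.
(* Subtracting a multiple of [quad0 z] beforehand turns the claim into an identity free of
   hypotheses. *)
have -> : quartic (fun i => l * lift3 z i + k * v i) =
  (quad0 (fun i => l * lift3 z i + k * v i) - l ^+ 2 * quad0 z) ^+ 2 +
  residual (fun i => l * lift3 z i + k * v i) by rewrite qz mulr0 subr0.
rewrite /residual tail4_lift3D /quartic /residual.
rewrite /contact1 /contact2 /contact3 /polar0 /quad0 /quad1 /quad2 /lift3 /=.
ring.
Qed.

(* Stereographic projection of the quadric surface from (1 : 0 : 0 : t). *)
Definition quadric_point (p : nat -> A) : nat -> A :=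
  let c := nth 0 [:: 1; 0; 0; t] in
  fun i => quad0 p * c i - 2 * polar0 c p * p i.

Lemma quadric_pointP p : quad0 (quadric_point p) = 0.
Proof. rewrite /quadric_point /polar0 /quad0 /=; ring. Qed.

(** The equation [contact1 z v = 0] solved for [v 4], whose coefficient is [z 1 ^+ 3]; that factor
    scales the other coordinates to avoid a division. *)
Definition tangent_vector z w : nat -> A := fun i =>
  if i == 4%N then - (4 * z 0%N ^+ 3 * (w 5%N + w 6%N - 2 * w 0%N)
                      + 32 * z 2%N ^+ 3 * (w 6%N - w 5%N))
  else z 1%N ^+ 3 * w i.

Lemma contact1_tangent z w : contact1 z (tangent_vector z w) = 0.
Proof. rewrite /contact1 /tangent_vector /=; ring. Qed.

(* The direction (0, 3 z2, - z1, 0), tangent to the quadric surface at z,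
   lies on the quadric contact2 z = 0; contact2_slope z is its polar form. *)
Definition ruling z : nat -> A := nth 0 [:: 0; 3 * z 2%N; - z 1%N].

Definition contact2_slope z v :=
  3 * t * z 1%N * z 2%N * (3 * z 1%N * v 4%N - 32 * z 2%N * (v 6%N - v 5%N)).

(** Second intersection of the line through [ruling z] and [v] with the quadric [contact2 z = 0]: as
    the ruling is a zero of this form Q with polar form B, Q(l r + k v) = k (l B(r, v) + k Q(v)). *)
Definition asymptotic_vector z v : nat -> A :=
  fun i => contact2 z v * ruling z i - contact2_slope z v * v i.

Lemma contact1_asymptotic z v :
  contact1 z v = 0 -> contact1 z (asymptotic_vector z v) = 0.
Proof.
move=> v1; rewrite (_ : contact1 z _ = - contact2_slope z v * contact1 z v).
  by rewrite v1 mulr0.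
rewrite /asymptotic_vector; set l := contact2 z v; set k := contact2_slope z v.
by rewrite /contact1 /ruling /=; ring.
Qed.

Lemma contact2_asymptotic z v : contact2 z (asymptotic_vector z v) = 0.
Proof.
rewrite /asymptotic_vector; set l := contact2 z v; set k := contact2_slope z v.
transitivity (k ^+ 2 * contact2 z v - l * k * contact2_slope z v).
  by rewrite /contact2 /contact2_slope /polar0 /ruling /=; ring.
by rewrite -/l -/k; ring.
Qed.

(** When the first two contacts vanish, [quartic_chord] leaves k^3 (l contact3 + k quartic v), whose
    remaining root is taken here. *)
Definition residual_point z v : nat -> A :=
  fun i => quartic v * lift3 z i - contact3 z v * v i.

Lemma quartic_residual_point z v : quad0 z = 0 ->
  contact1 z v = 0 -> contact2 z v = 0 -> quartic (residual_point z v) = 0.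
Proof.
move=> qz v1 v2; rewrite /residual_point.
set l := quartic v; set k := contact3 z v.
rewrite (_ : (fun i => _) = (fun i => l * lift3 z i + (- k) * v i)).
  by rewrite quartic_chord // v1 v2 -/l -/k; ring.
by apply/funext => i; rewrite mulNr.
Qed.

Definition asymptotic_param z w := asymptotic_vector z (tangent_vector z w).

Definition param (y : nat -> A) : nat -> A :=
  let z := quadric_point y in
  residual_point z (asymptotic_param z (fun i => y (4 + i)%N)).

Lemma quartic_param y : quartic (param y) = 0.
Proof.
apply: quartic_residual_point; first exact: quadric_pointP.
- by apply: contact1_asymptotic; exact: contact1_tangent.
- exact: contact2_asymptotic.
Qed.

End QuarticFamily.

(** * Compatibility with ring morphisms, and the forms themselves *)

Section QuarticMorphism.
Variables (A B : comNzRingType) (phi : {rmorphism A -> B}).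
Variables (m : nat) (t : A).
Implicit Types x z v y : nat -> A.

Let phiD a b a' b' : phi a = a' -> phi b = b' -> phi (a + b) = a' + b'.
Proof. by move=> <- <-; rewrite rmorphD. Qed.
Let phiM a b a' b' : phi a = a' -> phi b = b' -> phi (a * b) = a' * b'.
Proof. by move=> <- <-; rewrite rmorphM. Qed.
Let phiN a a' : phi a = a' -> phi (- a) = - a'.
Proof. by move=> <-; rewrite rmorphN. Qed.
Let phiX n a a' : phi a = a' -> phi (a ^+ n) = a' ^+ n.
Proof. by move=> <-; rewrite rmorphXn. Qed.
Let phi_nat n : phi n%:R = n%:R.
Proof. exact: rmorph_nat. Qed.

Ltac push_morphism := repeat lazymatch goal with
  | |- _ = _ + _ => apply: phiD
  | |- _ = _ * _ => apply: phiM
  | |- _ = - _ => apply: phiN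
  | |- _ = _ ^+ _ => apply: phiX
  | |- _ = _%:R => exact: phi_nat
  | |- _ => reflexivity
  end.

Lemma quad0_morph x : phi (quad0 t x) = quad0 (phi t) (phi \o x).
Proof. by rewrite /quad0; push_morphism. Qed.

Lemma quad1_morph x : phi (quad1 x) = quad1 (phi \o x).
Proof. by rewrite /quad1; push_morphism. Qed.

Lemma quad2_morph x : phi (quad2 x) = quad2 (phi \o x).
Proof. by rewrite /quad2; push_morphism. Qed.

Lemma residual_morph x : phi (residual m t x) = residual m (phi t) (phi \o x).
Proof.
apply: phiD; last first.
  by rewrite rmorph_sum; apply: eq_bigr => i _; apply: phiX.
rewrite /quad1 /quad2; apply: phiD; apply: phiM; push_morphism; exact: (phi_nat 1).
Qed.

Lemma quartic_morph x : phi (quartic m t x) = quartic m (phi t) (phi \o x).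
Proof. exact: phiD (phiX _ (quad0_morph x)) (residual_morph x). Qed.

Lemma gradient_morph x i : phi (gradient t x i) = gradient (phi t) (phi \o x) i.
Proof.
rewrite /gradient /quad0 /quad1 /quad2.
by do 7?[case: i => [|i] /=]; rewrite ?nth_nil; push_morphism; exact: (phi_nat 1).
Qed.

Lemma param_morph y i : phi (param m t y i) = param m (phi t) (phi \o y) i.
Proof.
have nthE s k : phi (nth 0 s k) = nth 0 (map phi s) k.
  by elim: s k => [|a s IH] [|k] //=; rewrite rmorph0.
have zE : phi \o quadric_point t y = quadric_point (phi t) (phi \o y).
  apply/funext => k; rewrite /quadric_point /polar0 /quad0 /=.
  by push_morphism; rewrite ?nthE /= ?rmorph0 ?rmorph1.
have rE z v : phi \o residual_point m t z v =
    residual_point m (phi t) (phi \o z) (phi \o v).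
  apply/funext => k; rewrite /residual_point /= rmorphB !rmorphM quartic_morph.
  rewrite /lift3 nthE /= rmorph0; congr (_ - _ * _).
  by rewrite /contact3 /polar0 /quad0 /quad1 /quad2; push_morphism; exact: phi_nat 1.
have aE z w : phi \o asymptotic_param t z w =
    asymptotic_param (phi t) (phi \o z) (phi \o w).
  have tE : phi \o tangent_vector z w = tangent_vector (phi \o z) (phi \o w).
    apply/funext => k; rewrite /tangent_vector /=.
    by case: eqP => _; push_morphism.
  rewrite /asymptotic_param -tE; set v := tangent_vector z w.
  apply/funext => k.
  apply: phiD; last by rewrite /contact2_slope; push_morphism.
  apply: phiM; first by rewrite /contact2 /polar0; push_morphism; exact: phi_nat 1.
  by rewrite /ruling nthE /= rmorph0 rmorphM rmorphN phi_nat.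
have := congr1 (fun g => g i) (rE (quadric_point t y)
  (asymptotic_param t (quadric_point t y) (fun i => y (4 + i)%N))).
by rewrite aE zE.
Qed.

End QuarticMorphism.

Section Forms.
Variables (R : comNzRingType) (m : nat) (t : R).

Definition quartic_form : {mpoly R[m.+4.+3]} :=
  quartic m t%:MP (fun i => 'X_(inord i)).

Definition param_forms : (m.+4.+3).-tuple {mpoly R[m.+4.+4.+3]} :=
  [tuple param m t%:MP (fun j => 'X_(inord j)) i | i < m.+4.+3].

Lemma tnth_param_forms i :
  tnth param_forms i = param m t%:MP (fun j => 'X_(inord j)) i.
Proof. by rewrite tnth_mktuple. Qed.

(** Passage between indices in nat and in 'I_(m + 7): only indices below m + 7 are read, and [inord]
    preserves them. *)
Lemma quartic_inord (A : comNzRingType) (c : A) (x : nat -> A) :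
  quartic m c x = quartic m c (fun i => x (@inord m.+4.+2 i)).
Proof.
rewrite /quartic /residual; congr (_ + (_ + _)).
- by rewrite /quad0 !inordK.
- by rewrite /quad1 /quad2 !inordK.
- by apply: eq_bigr => i _; rewrite inordK // -[m.+4.+3]/(7 + m)%N ltn_add2l.
Qed.

Lemma quartic_form_comp l (g : (m.+4.+3).-tuple {mpoly R[l]}) :
  quartic_form \mPo g = quartic m t%:MP (fun i => tnth g (inord i)).
Proof.
rewrite [LHS](quartic_morph (comp_mpoly g)) /= comp_mpolyC; congr (quartic _ _ _).
by apply/funext => i /=; rewrite comp_mpolyXU -tnth_nth.
Qed.

Lemma quartic_form_param_forms : quartic_form \mPo param_forms = 0.
Proof.
rewrite quartic_form_comp.
under [fun i => _]funext do rewrite tnth_param_forms.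
by rewrite -quartic_inord quartic_param.
Qed.

End Forms.

Section FormsMap.
Variables (R S : comNzRingType) (iota : {rmorphism R -> S}) (m : nat) (t : R).

Lemma map_param_forms i :
  map_mpoly iota (tnth (param_forms m t) i) = tnth (param_forms m (iota t)) i.
Proof.
rewrite !tnth_param_forms [LHS](param_morph (map_mpoly iota)) /= map_mpolyC.
rewrite (_ : _ \o _ = fun j => 'X_(inord j)) //.
by apply/funext => j /=; rewrite map_mpolyX.
Qed.

Lemma mmap_quartic_form (h : 'I_m.+4.+3 -> S) :
  mmap iota h (quartic_form m t) = quartic m (iota t) (fun i => h (inord i)).
Proof.
rewrite [LHS](quartic_morph (mmap iota h)) /= mmapC; congr (quartic _ _ _).
by apply/funext => i /=; rewrite mmapX mmap1U.
Qed.

Lemma mmap_param_forms (h : 'I_m.+4.+4.+3 -> S) i :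
  mmap iota h (tnth (param_forms m t) i) =
  param m (iota t) (fun j => h (inord j)) i.
Proof.
rewrite tnth_param_forms [LHS](param_morph (mmap iota h)) /= mmapC.
rewrite (_ : _ \o _ = fun j => h (inord j)) //.
by apply/funext => j /=; rewrite mmapX mmap1U.
Qed.

End FormsMap.

Lemma meval_quartic_form (R : comNzRingType) m (t : R) (x : 'I_m.+4.+3 -> R) :
  (quartic_form m t).@[x] = quartic m t (fun i => x (inord i)).
Proof. exact: (mmap_quartic_form idfun). Qed.

(** * Degrees of the forms *)

Section Homogeneity.
Variables (R : comNzRingType) (l : nat).
Implicit Types (p q : {mpoly R[l]}) (x z v : nat -> {mpoly R[l]}).

Definition hom d p := p \is d.-homog.

Lemma homD d e p q : hom d p -> hom e q -> d = e -> hom d (p + q).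
Proof. by move=> hp hq de; rewrite /hom rpredD // de. Qed.
Lemma homN d p : hom d p -> hom d (- p).
Proof. by rewrite /hom rpredN. Qed.
Lemma homM d e p q : hom d p -> hom e q -> hom (d + e) (p * q).
Proof. exact: dhomogM. Qed.
Lemma homX d k p : hom d p -> hom (d * k) (p ^+ k).
Proof. exact: dhomogMn. Qed.
Lemma homC c : hom 0 (c%:MP).
Proof. by rewrite /hom -[c%:MP]mulr1 mul_mpolyC; apply: dhomogZ; exact: dhomog1. Qed.
Lemma hom_nat n : hom 0 (n%:R).
Proof. by rewrite -(rmorph_nat (@mpolyC l R)); exact: homC. Qed.
Lemma hom_cast d e p : hom d p -> d = e -> hom e p.
Proof. by move=> ? <-. Qed.

Ltac homog_step := lazymatch goal with
  | |- is_true (hom _ (_ + _)) => eapply homD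
  | |- is_true (hom _ (_ * _)) => eapply homM
  | |- is_true (hom _ (- _)) => eapply homN
  | |- is_true (hom _ (_ ^+ _)) => eapply homX
  | |- is_true (hom _ (_%:R)) => exact: hom_nat
  | |- is_true (hom _ 1) => exact: (hom_nat 1)
  | |- is_true (hom _ (_%:MP)) => exact: homC
  | |- is_true (hom _ (_ _)) => eauto
  end.
Ltac solve_homog := eapply hom_cast; [repeat homog_step; try reflexivity; try ring | try reflexivity; try ring].

Lemma hom_quad0 (t : R) x e : (forall i, hom e (x i)) -> hom (2 * e) (quad0 t%:MP x).
Proof. by move=> hx; rewrite /quad0; solve_homog. Qed.

Lemma hom_quad1 x e : (forall i, hom e (x i)) -> hom (2 * e) (quad1 x).
Proof. by move=> hx; rewrite /quad1; solve_homog. Qed.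

Lemma hom_quad2 x e : (forall i, hom e (x i)) -> hom (2 * e) (quad2 x).
Proof. by move=> hx; rewrite /quad2; solve_homog. Qed.

Lemma hom_quartic m (t : R) x e :
  (forall i, hom e (x i)) -> hom (4 * e) (quartic m t%:MP x).
Proof.
move=> hx.
have h0 := hom_quad0 t hx; have h1 := hom_quad1 hx; have h2 := hom_quad2 hx.
have h4 : hom (4 * e) (tail4 m x).
  by apply: rpred_sum => i _; eapply hom_cast; [exact: homX | exact: mulnC].
by rewrite /quartic /residual; solve_homog.
Qed.

(** The degrees are 2 for the point z, 3 * 2 + 1 = 7 for the tangent vector, 2 (2 + 7) + 2 = 20 for
    the asymptotic vector, and 4 * 20 + 2 = 82 for the residual point. *)
Lemma hom_param m (t : R) x :
  (forall i, hom 1 (x i)) -> forall i, hom 82 (param m t%:MP x i).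
Proof.
move=> hx; rewrite /param.
have nthP (s : seq {mpoly R[l]}) d i : all (hom d) s -> hom d (nth 0 s i).
  move=> hs; have [lt_is|le_si] := ltnP i (size s).
    by apply: (allP hs); rewrite mem_nth.
  by rewrite nth_default // /hom rpred0.
set z := quadric_point _ _; set w := fun i => x (4 + i)%N.
have hw i : hom 1 (w i) by exact: hx.
have hz i : hom 2 (z i).
  have hq := hom_quad0 t hx.
  rewrite /z /quadric_point.
  set c := nth 0 _; have hc j : hom 0 (c j).
    by apply: nthP; rewrite /= (hom_nat 1) (homC t) /hom rpred0.
  by rewrite /polar0; solve_homog.
set v := tangent_vector z w.
have hv i : hom 7 (v i).
  by rewrite /v /tangent_vector; case: eqP => _; solve_homog.
have ha i : hom 20 (asymptotic_vector t%:MP z v i).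
  have hr j : hom 2 (ruling z j).
    by apply: nthP; rewrite /= andbT; apply/and3P; split; [by rewrite /hom rpred0| |]; solve_homog.
  by rewrite /asymptotic_vector /contact2 /contact2_slope /polar0; solve_homog.
move=> i; rewrite /residual_point /asymptotic_param -/v.
set u := asymptotic_vector _ _ _ in ha *.
have h4 := hom_quartic m t ha; have h0 := hom_quad0 t ha.
have h1 := hom_quad1 ha; have h2 := hom_quad2 ha.
have hl : hom 2 (lift3 z i).
  by apply: nthP; rewrite /= !hz /hom rpred0.
by rewrite /contact3 /polar0; solve_homog.
Qed.

End Homogeneity.

Lemma homog_quartic_form (R : comNzRingType) m (t : R) :
  quartic_form m t \is 4.-homog.
Proof.
by apply: (hom_quartic m t (e := 1)) => i; rewrite /hom dhomogX /= mdeg1.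
Qed.

Lemma homog_param_forms (R : comNzRingType) m (t : R) :
  forall i, tnth (param_forms m t) i \is 82.-homog.
Proof.
move=> i; rewrite tnth_param_forms; apply: hom_param => j.
by rewrite /hom dhomogX /= mdeg1.
Qed.

(** * Specialization at t = 0 *)

Lemma poly_eq0_horner (F : idomainType) (p : {poly F}) :
  injective (fun n : nat => n%:R : F) -> (forall c, p.[c] = 0) -> p = 0.
Proof.
move=> natI p0; apply/eqP/negP => /negP nz_p.
have := @max_poly_roots _ p [seq n%:R | n <- iota 0 (size p)] nz_p.
rewrite size_map size_iota ltnn => H; suff: false by []; apply: H.
  by apply/allP => _ /mapP[n _ ->]; apply/rootP.
by rewrite map_inj_uniq ?iota_uniq.
Qed.

Lemma rat_natI : injective (fun n : nat => n%:R : rat).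
Proof. by move=> a b /eqP; rewrite Num.Theory.eqr_nat => /eqP. Qed.

(** * Rational curves on the special fibre *)

Lemma rat_sqr5 (x y : rat) : x ^+ 2 = 5 * y ^+ 2 -> y = 0.
Proof.
have natP (a b : nat) : (a ^ 2 = 5 * b ^ 2)%N -> b = 0%N.
  move=> ab; apply/eqP; apply: contraT; rewrite -lt0n => b0.
  have := congr1 (logn 5) ab.
  rewrite lognM // ?expn_gt0 ?b0 // !lognX => /(congr1 odd).
  by rewrite oddD !oddM.
move=> xy; apply/eqP; apply: contraT => y0.
pose r := x / y.
have r2 : r ^+ 2 = 5 by rewrite /r expr_div_n xy mulfK // expf_neq0.
have := divq_num_den r; set a := numq r; set b := denq r => rE.
have b0 : b != 0 by exact: denq_neq0.
have ab : a ^+ 2 = 5 * b ^+ 2.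
  apply/eqP; rewrite -(eqr_int rat) !expr2 !intrM -!expr2 -[5%:~R]r2.
  by rewrite -rE expr_div_n divfK // expf_neq0 // intr_eq0.
have := natP `|a|%N `|b|%N; rewrite -!abszX ab abszM => /(_ erefl) /eqP.
by rewrite absz_eq0 (negPf b0).
Qed.

Lemma coefM_top (R : nzRingType) (p q : {poly R}) (i j : nat) :
  (size p <= i.+1)%N -> (size q <= j.+1)%N -> (p * q)`_(i + j) = p`_i * q`_j.
Proof.
move=> sp sq; have lt_i : (i < (i + j).+1)%N by rewrite ltnS leq_addr.
rewrite coefM (bigD1 (Ordinal lt_i)) //= addKn big1 ?addr0 // => k.
rewrite -val_eqE /= => k_i; have [lt_ki|le_ik] := ltnP k i.
  rewrite (nth_default _ (s := q)) ?mulr0 //; apply: leq_trans sq _; lia.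
by rewrite nth_default ?mul0r // (leq_trans sp) //; lia.
Qed.

Lemma dvdp_coprime_mul (F : fieldType) (a b d p : {poly F}) :
  coprimep a b -> d %| a * p -> d %| b * p -> d %| p.
Proof.
move=> /Bezout_eq1_coprimepP[[u v] /= uv] da db.
have -> : p = u * (a * p) + v * (b * p) by rewrite !mulrA -mulrDl uv mul1r.
by rewrite dvdp_add ?(dvdp_mull _ da) ?(dvdp_mull _ db).
Qed.

(* The pair of quadrics e^2 = a^2 + 5 b^2, g^2 = a^2 - 5 b^2 is a curve of
   genus one.  On a parametrization the coprime polynomials e and g divide the
   Wronskian of a and b, whose degree is too small. *)
Lemma elliptic_coprime_const (a b e g : {poly rat}) : coprimep a b ->
  e ^+ 2 = a ^+ 2 + 5%:P * b ^+ 2 -> g ^+ 2 = a ^+ 2 + (-5)%:P * b ^+ 2 ->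
  (size a <= 1)%N /\ (size b <= 1)%N.
Proof.
move=> ab eE gE; set W := a * b^`() - a^`() * b.
have two_inj (p q : {poly rat}) : p + p = q + q -> p = q.
  rewrite -!mulr2n -!scaler_nat => /(congr1 (fun r => 2%:R^-1 *: r)).
  by rewrite !scalerA mulVf // !scale1r.
have divW (f : {poly rat}) (c : rat) : c != 0 ->
    f ^+ 2 = a ^+ 2 + c%:P * b ^+ 2 -> f %| W.
  move=> c0 fE.
  have dfE : f * f^`() = a * a^`() + c%:P * (b * b^`()).
    apply: two_inj; have := congr1 (@deriv _) fE.
    rewrite !expr2 derivD mul_polyC derivZ !derivM -mul_polyC => H.
    by transitivity (f^`() * f + f * f^`()); [ring | rewrite H; ring].
  apply: (dvdp_coprime_mul ab).
    have -> : a * W = f * (f * b^`() - f^`() * b).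
      transitivity (f ^+ 2 * b^`() - (f * f^`()) * b); last by ring.
      by rewrite fE dfE /W; ring.
    by rewrite dvdp_mulr.
  rewrite -(dvdpZr _ _ c0) -mul_polyC.
  have -> : c%:P * (b * W) = f * (f^`() * a - f * a^`()).
    transitivity ((f * f^`()) * a - f ^+ 2 * a^`()); last by ring.
    by rewrite fE dfE /W; ring.
  by rewrite dvdp_mulr.
have eg : coprimep e g.
  have /Bezout_eq1_coprimepP[[u v] /= uv] : coprimep (a ^+ 2) (b ^+ 2).
    by rewrite coprimep_expl // coprimep_expr.
  apply/Bezout_eq1_coprimepP.
  (* The relations e^2 + g^2 = 2 a^2 and e^2 - g^2 = 10 b^2 convert a Bezout identity for a^2, b^2
     into one for e, g. *)
  pose r := u * (2^-1)%:P; pose s := v * (10^-1)%:P.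
  exists ((r + s) * e, (r - s) * g) => /=.
  rewrite -!mulrA -!expr2 eE gE -uv polyCN.
  have h2 : (2^-1 : rat)%:P * 2 = 1 by rewrite -(rmorph_nat polyC) -polyCM mulVf.
  have h10 : (10^-1 : rat)%:P * 10 = 1 by rewrite -(rmorph_nat polyC) -polyCM mulVf.
  transitivity (u * ((2^-1)%:P * 2) * a ^+ 2 + v * ((10^-1)%:P * 10) * b ^+ 2).
    by rewrite /r /s (_ : 5%:P = 5) ?rmorph_nat //; ring.
  by rewrite h2 h10 !mulr1.
have egW : e * g %| W by rewrite Gauss_dvdp // (divW e 5) // (divW g (-5)).
pose D := maxn (size a) (size b).
(* The forms x^2 + 5 y^2 and x^2 - 5 y^2 are anisotropic over Q, so the top coefficients cannot
   cancel and e, g are as large as the larger of a, b. *)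
have sizeD (f : {poly rat}) (c : rat) :
    (forall x y, x ^+ 2 + c * y ^+ 2 = 0 -> x = 0 /\ y = 0) ->
    f ^+ 2 = a ^+ 2 + c%:P * b ^+ 2 -> (D <= size f)%N.
  move=> c_ani fE; rewrite leqNgt; apply/negP => lt_fD.
  have /prednK D1 : (0 < D)%N by exact: leq_ltn_trans lt_fD.
  have top (p : {poly rat}) : (size p <= D)%N ->
      (p ^+ 2)`_(D.-1 + D.-1) = p`_D.-1 ^+ 2.
    by move=> sp; rewrite !expr2 coefM_top // D1.
  have := congr1 (fun p : {poly rat} => p`_(D.-1 + D.-1)) fE.
  rewrite coefD coefCM !top ?leq_maxl ?leq_maxr ?(ltnW lt_fD) //.
  have -> : f`_D.-1 = 0 by apply: nth_default; rewrite -ltnS D1.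
  rewrite expr0n /= => /esym/c_ani[a0 b0].
  have : (maxn (size a) (size b) <= D.-1)%N.
    have bound (p : {poly rat}) : (size p <= D)%N -> p`_D.-1 = 0 -> (size p <= D.-1)%N.
      move=> sp p0; rewrite leqNgt; apply/negP => lt_p.
      have sE : size p = D by apply/eqP; rewrite eqn_leq sp -D1.
      move/eqP: p0; rewrite -sE -lead_coefE lead_coef_eq0 => /eqP p0.
      by move: lt_p; rewrite p0 size_poly0.
    by rewrite geq_max !bound ?leq_maxl ?leq_maxr.
  by rewrite -/D -{1}D1 ltnn.
have se : (D <= size e)%N.
  apply: (sizeD e 5) => // x y xy; have x2 := sqr_ge0 x; have y2 := sqr_ge0 y.
  by split; apply/eqP; rewrite -sqrf_eq0; apply/eqP; lra.
have sg : (D <= size g)%N.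
  apply: (sizeD g (-5)) => // x y xy; have xE : x ^+ 2 = 5 * y ^+ 2 by lra.
  have y0 := rat_sqr5 xE; split=> //; apply/eqP; rewrite -sqrf_eq0 xE y0.
  by rewrite expr0n mulr0.
have D0 : (0 < D)%N.
  rewrite lt0n; apply/negP; rewrite -leqn0 geq_max !leqn0 !size_poly_eq0.
  case/andP => /eqP a0 /eqP b0; move: ab.
  by rewrite a0 b0 coprimep0 eqp01.
(* Otherwise e g, of size at least 2 D - 1, would divide W, of size at most 2 D - 2. *)
have W0 : W = 0.
  apply/eqP/negP => /negP nzW.
  have e0 : e != 0 by rewrite -size_poly_gt0 (leq_trans D0).
  have g0 : g != 0 by rewrite -size_poly_gt0 (leq_trans D0).
  have := dvdp_leq nzW egW; rewrite size_mul // leqNgt => /negP; apply.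
  have sW (p q : {poly rat}) : (size p <= D)%N -> (size q <= D)%N ->
      (size (p * q^`() : {poly rat})%R <= (D + D).-2)%N.
    move=> sp sq; have [->|q0] := eqVneq q 0.
      by rewrite deriv0 mulr0 size_poly0.
    apply: leq_trans (size_polyMleq _ _) _; have := lt_size_deriv q0; lia.
  apply: leq_ltn_trans (size_polyD _ _) _; rewrite size_polyN gtn_max.
  rewrite [a^`() * b]mulrC.
  have lt_eg : ((D + D).-2 < (size e + size g).-1)%N by lia.
  by rewrite !(leq_ltn_trans _ lt_eg) // sW ?leq_maxl ?leq_maxr.
have W0' : a * b^`() = a^`() * b by apply/subr0_eq.
have const (p q r : {poly rat}) : coprimep p q -> p * r = p^`() * q -> (size p <= 1)%N.
  move=> pq prE; have : p %| p^`() by rewrite -(Gauss_dvdpl _ pq) -prE dvdp_mulr.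
  have [->|p0] := eqVneq p 0; first by rewrite size_poly0.
  case: (eqVneq p^`() 0) => [dp0 _|dp0 /(dvdp_leq dp0)]; last by rewrite leqNgt lt_size_deriv.
  rewrite leqNgt; apply/negP => sp.
  have := congr1 (fun f : {poly rat} => f`_(size p).-2) dp0.
  rewrite coef_deriv coef0 => /eqP; rewrite mulrn_eq0 /=.
  have -> : (size p).-2.+1 = (size p).-1 by case: (size p) sp => [|[]].
  by rewrite -lead_coefE lead_coef_eq0 (negPf p0) /=; lia.
split; first exact: const W0'.
by apply: (const b a a^`()); rewrite 1?coprimep_sym // mulrC -W0' mulrC.
Qed.

(** The gcd of a and b also divides e and g, since its square divides their squares; dividing by it
    leaves the coprime case. *)
Lemma elliptic_curve_const (a b e g : {poly rat}) :
  e ^+ 2 = a ^+ 2 + 5%:P * b ^+ 2 -> g ^+ 2 = a ^+ 2 + (-5)%:P * b ^+ 2 ->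
  exists h : {poly rat}, exists c : 'I_4 -> rat,
    [/\ a = h * (c 0)%:P, b = h * (c 1)%:P, e = h * (c 2)%:P & g = h * (c 3)%:P].
Proof.
move=> eE gE; have [/andP[/eqP a0 /eqP b0]|] := boolP ((a == 0) && (b == 0)).
  move: eE gE; rewrite a0 b0 expr0n !mulr0 addr0 => /eqP + /eqP.
  rewrite !sqrf_eq0 => /eqP -> /eqP ->.
  by exists 0, (fun=> 0); rewrite !mul0r.
rewrite negb_and => ab0; pose d := gcdp a b.
have d0 : d != 0 by rewrite gcdp_eq0 negb_and.
have ab := coprimep_div_gcd ab0; rewrite -/d in ab.
have aE : a = d * (a %/ d) by rewrite mulrC divpK // dvdp_gcdl.
have bE : b = d * (b %/ d) by rewrite mulrC divpK // dvdp_gcdr.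
have reduce (f : {poly rat}) (c : rat) : f ^+ 2 = a ^+ 2 + c%:P * b ^+ 2 ->
    f = d * (f %/ d) /\ (f %/ d) ^+ 2 = (a %/ d) ^+ 2 + c%:P * (b %/ d) ^+ 2.
  move=> fE; have fdE : f = d * (f %/ d).
    rewrite mulrC divpK // -(@dvdp_pexp2r _ _ _ 2) // fE dvdp_add //.
      by rewrite dvdp_exp2r // dvdp_gcdl.
    by rewrite dvdp_mull // dvdp_exp2r // dvdp_gcdr.
  split=> //; apply: (mulfI (expf_neq0 2 d0)).
  by rewrite -exprMn -fdE fE [in LHS]aE [in LHS]bE; ring.
have [eE' e1E] := reduce _ _ eE; have [gE' g1E] := reduce _ _ gE.
have [sa sb] := elliptic_coprime_const ab e1E g1E.
have size2 (f : {poly rat}) (c : rat) :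
    f ^+ 2 = (a %/ d) ^+ 2 + c%:P * (b %/ d) ^+ 2 -> (size f <= 1)%N.
  rewrite (size1_polyC sa) (size1_polyC sb) -!rmorphXn -polyCM -polyCD => fE.
  have := size_exp f 2; rewrite fE size_polyC; rewrite (_ : (_ : bool).-1 = 0%N); last by case: (_ != 0).
  by case: (size _) => [|[|k]].
exists d, (fun i => nth 0 [:: (a %/ d)`_0; (b %/ d)`_0; (e %/ d)`_0; (g %/ d)`_0] i).
by rewrite /= -!size1_polyC ?(size2 _ _ e1E) ?(size2 _ _ g1E).
Qed.

Lemma quartic0_rat m (x : nat -> rat) : quartic m 0 x = 0 ->
  [/\ forall i, (0 < i < 4)%N || (6 < i < 7 + m)%N -> x i = 0,
      quad1 x = 0 & quad2 x = 0].
Proof.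
rewrite /quartic /residual subr0 mul1r mul0r addr0.
have tail_ge0 : 0 <= tail4 m x by apply: sumr_ge0 => i _; rewrite (exprM _ 2 2) sqr_ge0.
have q0 := sqr_ge0 (quad0 0 x); have q1 := sqr_ge0 (quad1 x).
have q2 := sqr_ge0 (quad2 x) => f0.
have sq0 (r : rat) : r ^+ 2 = 0 -> r = 0 by move/eqP; rewrite sqrf_eq0 => /eqP.
have /sq0 q00 : quad0 0 x ^+ 2 = 0 by lra.
have /sq0 q10 : quad1 x ^+ 2 = 0 by lra.
have /sq0 q20 : quad2 x ^+ 2 = 0 by lra.
have t0 : tail4 m x = 0 by lra.
split=> // i /orP[|/andP[i6 im]]; last first.
  have /eqP := t0; rewrite psumr_eq0 => [|j _]; last by rewrite (exprM _ 2 2) sqr_ge0.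
  have im' : (i - 7 < m)%N by lia.
  move/allP/(_ (Ordinal im') (mem_index_enum _)) => /=.
  by rewrite subnKC // expf_eq0 => /eqP.
have s1 := sqr_ge0 (x 1%N); have s2 := sqr_ge0 (x 2%N); have s3 := sqr_ge0 (x 3%N).
move: q00; rewrite /quad0 expr0n mul0r subr0 => q00.
by case: i => [|[|[|[|]]]] // _; apply: sq0; lra.
Qed.

(** Positivity is available in Q only, so it is used at every rational value of the variable; the
    four coordinates left then parametrize the genus one curve. *)
Lemma quartic0_const m (x : nat -> {poly rat}) : quartic m 0 x = 0 ->
  exists h : {poly rat}, exists c : nat -> rat,
    forall i, (i < 7 + m)%N -> x i = h * (c i)%:P.
Proof.
move=> x0.
have at_point (y : rat) : quartic m 0 (fun i => (x i).[y]) = 0.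
  by have := quartic_morph (horner_eval y) m 0 x; rewrite x0 /= /horner_eval !horner0.
have zero i : (0 < i < 4)%N || (6 < i < 7 + m)%N -> x i = 0.
  move=> hi; apply: (poly_eq0_horner rat_natI) => y.
  by have [/(_ i hi)] := quartic0_rat (at_point y).
have q1 : quad1 x = 0.
  apply: (poly_eq0_horner rat_natI) => y; have [_ + _] := quartic0_rat (at_point y).
  by have := quad1_morph (horner_eval y) x => /[swap]; rewrite /= /horner_eval => ->.
have q2 : quad2 x = 0.
  apply: (poly_eq0_horner rat_natI) => y; have [_ _] := quartic0_rat (at_point y).
  by have := quad2_morph (horner_eval y) x => /[swap]; rewrite /= /horner_eval => ->.
have P5 : 5%:P = 5 :> {poly rat} by rewrite rmorph_nat.
have [h [c [aE bE eE gE]]] : exists h : {poly rat}, exists c : 'I_4 -> rat,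
    [/\ x 0%N = h * (c 0)%:P, x 4%N = h * (c 1)%:P,
        x 5%N = h * (c 2)%:P & x 6%N = h * (c 3)%:P].
  apply: elliptic_curve_const; rewrite ?polyCN P5; apply: subr0_eq.
    by rewrite -[RHS]q1 /quad1; ring.
  by rewrite -[RHS]q2 /quad2; ring.
exists h, (nth 0 [:: c 0; 0; 0; 0; c 1; c 2; c 3]) => i lt_i.
have [i7|i7] := ltnP i 7; last by rewrite nth_default // mulr0 zero // i7 lt_i orbT.
case: i i7 {lt_i} => [|[|[|[|[|[|[|//]]]]]]] _ //=; by rewrite ?mulr0 ?zero.
Qed.

(** * Degeneration along the Newton polygon *)

Definition proportional (k : nat) (u v : nat -> rat) :=
  exists2 c : rat, c != 0 & forall j, (j < k)%N -> v j = c * u j.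

Lemma proportional_trans k u v w :
  proportional k u v -> proportional k v w -> proportional k u w.
Proof.
move=> [c c0 uv] [c' c'0 vw]; exists (c' * c); first by rewrite mulf_neq0.
by move=> j lt_jk; rewrite vw // uv // mulrA.
Qed.

Lemma quartic_scale (R : comNzRingType) m (t c : R) x :
  quartic m t (fun i => c * x i) = c ^+ 4 * quartic m t x.
Proof.
rewrite /quartic /residual /quad0 /quad1 /quad2.
rewrite (_ : tail4 m _ = c ^+ 4 * tail4 m x); first ring.
by rewrite /tail4 mulr_sumr; apply: eq_bigr => i _; rewrite exprMn.
Qed.

(** The common power of X is extracted from a vector; the conditional last clause accommodates the
    zero vector. *)
Lemma poly_mulX_fact (p : nat -> {poly rat}) k :
  exists w, exists b : nat -> {poly rat}, (forall j, (j < k)%N -> p j = 'X^w * b j) /\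
    ((exists2 j, (j < k)%N & p j != 0) -> exists2 j, (j < k)%N & (b j).[0] != 0).
Proof.
have [[j lt_jk pj]|p0] := pselect (exists2 j, (j < k)%N & p j != 0); last first.
  by exists 0%N, p; split=> // j _; rewrite expr0 mul1r.
have [n] := ubnP (size (p j)); elim: n p pj => // n IH p pj lt_n.
have [[i lt_ik pi]|p0] := pselect (exists2 i, (i < k)%N & (p i).[0] != 0).
  by exists 0%N, p; split=> [? _|_]; [rewrite expr0 mul1r | exists i].
pose q i := p i %/ 'X.
have pE i : (i < k)%N -> p i = 'X * q i.
  move=> lt_ik; rewrite mulrC divpK // -['X]subr0 dvdp_XsubCl; apply/rootP.
  by apply/eqP/negP => /negP pi; case: p0; exists i.
have qj : q j != 0 by apply: contraNneq pj => qj; rewrite pE // qj mulr0.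
have lt_q : (size (q j) < n)%N.
  by move: lt_n; rewrite pE // mulrC size_mulX // ltnS.
have [w [b [qE b0]]] := IH q qj lt_q.
exists w.+1, b; split; last by move=> _; apply: b0; exists j.
by move=> i lt_ik; rewrite pE // qE // mulrA -exprS.
Qed.

Section NewtonChain.
Variables (m d : nat) (w : nat -> nat) (B : nat -> nat -> {poly rat}).

(* The curve whose coefficient of u^i v^(d - i) is the vector t^(w i) B i. *)
Hypothesis curve0 : forall (R : comNzRingType) (phi : {rmorphism {poly rat} -> R}) (u v : R),
  quartic m (phi 'X) (fun j => \sum_(i < d.+1)
    phi ('X^(w i) * B i j) * u ^+ i * v ^+ (d - i)) = 0.

Definition lead i j : rat := (B i j).[0].
Definition nz i := `[< exists2 j, (j < 7 + m)%N & lead i j != 0 >].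

(** Each nonzero coefficient vector is normalized to be nonzero at t = 0, so a vector with zero
    reduction is zero and gives no point of the Newton polygon. *)
Hypothesis B0 : forall i, (i <= d)%N -> ~~ nz i -> forall j, B i j = 0.

(* Substituting t = tau^N, u = s tau^h1, v = tau^h2 and dividing by the highest
   power of tau leaves, at tau = 0, a curve in the special fibre. *)
Lemma edge_proportional (N h1 h2 c i0 i1 : nat) :
  (0 < N)%N -> (i0 <= d)%N -> (i1 <= d)%N -> nz i0 -> nz i1 ->
  (forall i, (i <= d)%N -> nz i -> c <= N * w i + h1 * i + h2 * (d - i))%N ->
  c = (N * w i0 + h1 * i0 + h2 * (d - i0))%N ->
  c = (N * w i1 + h1 * i1 + h2 * (d - i1))%N ->
  proportional (7 + m) (lead i0) (lead i1).
Proof.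
move=> N0 le0 le1 nz0 nz1 c_min c0 c1.
pose e i := (N * w i + h1 * i + h2 * (d - i))%N.
(* The outer variable is tau and the inner one s; [phi] substitutes tau^N for t. *)
pose phi : {rmorphism {poly rat} -> {poly {poly rat}}} :=
  (comp_poly 'X^N : {rmorphism _ -> _}) \o map_poly polyC.
pose Y j : {poly {poly rat}} :=
  \sum_(i < d.+1) phi (B i j) * 'X%:P ^+ i * 'X^(e i - c).
have phiX : phi 'X = 'X^N by rewrite /phi /= map_polyX comp_polyX.
have curveY : (fun j => \sum_(i < d.+1)
    phi ('X^(w i) * B i j) * ('X%:P * 'X^h1) ^+ i * 'X^h2 ^+ (d - i)) =
  (fun j => 'X^c * Y j).
  apply/funext => j; rewrite /Y mulr_sumr; apply: eq_bigr => i _.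
  have le_id : (i <= d)%N by rewrite -ltnS.
  have [nzi|/B0 ->] := boolP (nz i); rewrite ?mulr0 ?rmorph0 ?mul0r ?mulr0 //.
  rewrite rmorphM rmorphXn phiX exprMn -!exprM.
  transitivity ('X^(e i) * (phi (B i j) * 'X%:P ^+ i)); first by rewrite /e !exprD; ring.
  have ei : e i = (c + (e i - c))%N by rewrite subnKC // c_min.
  by rewrite {1}ei exprD; ring.
have Y0 : quartic m 'X^N Y = 0.
  have := curve0 phi ('X%:P * 'X^h1) 'X^h2; rewrite curveY quartic_scale phiX.
  by move=> /eqP; rewrite mulf_eq0 expf_eq0 expf_eq0 polyX_eq0 andbF => /eqP.
have [h [v hv]] : exists h : {poly rat}, exists v : nat -> rat,
    forall j, (j < 7 + m)%N -> (Y j).[0] = h * (v j)%:P.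
  apply: quartic0_const; have := quartic_morph (horner_eval 0) m 'X^N Y.
  by rewrite Y0 /= /horner_eval horner0 hornerXn expr0n eqn0Ngt N0 => <-.
(* At tau = 0 only the indices with e i = c survive, and the coefficient of s^i isolates each of
   them. *)
have coefY i j : (i <= d)%N -> c = e i -> (j < 7 + m)%N -> lead i j = h`_i * v j.
  move=> le_id ci lt_j; rewrite -coefMC -hv // /Y horner_sum coef_sum.
  have lt_id : (i < d.+1)%N by [].
  have phi0 b : (phi b).[0] = (b.[0])%:P.
    rewrite /phi /= horner_comp hornerXn expr0n eqn0Ngt N0 /=.
    by rewrite -[X in _.[X] = _]polyC0 horner_map.
  rewrite (bigD1 (Ordinal lt_id)) //= big1 ?addr0 => [|k ki].
    rewrite !hornerM phi0 -ci subnn expr0 hornerC mulr1 -polyC_exp hornerC.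
    by rewrite coefCM coefXn eqxx mulr1.
  rewrite !hornerM phi0 -polyC_exp hornerC hornerXn -mulrA coefCM.
  rewrite -polyC0 -polyC_exp coefMC coefXn.
  by move: ki; rewrite -val_eqE /= eq_sym => /negPf ->; rewrite mul0r mulr0.
have /asboolP[j0 lt0 l0] := nz0; have /asboolP[j1 lt1 l1] := nz1.
have h0 : h`_i0 != 0 by apply: contraNneq l0 => h0; rewrite coefY // h0 mul0r.
have h1' : h`_i1 != 0 by apply: contraNneq l1 => h1'; rewrite coefY // h1' mul0r.
exists (h`_i1 / h`_i0); first by rewrite mulf_neq0 ?invr_eq0.
by move=> j lt_j; rewrite !coefY // mulrA divfK.
Qed.

Lemma newton_chain : nz 0 -> nz d -> proportional (7 + m) (lead 0) (lead d).
Proof.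
move=> nz0 nzd.
(* Invariant of the walk along the lower hull of the points (i, w i): some line of slope s through
   (j, w j) stays below all of them. *)
suff chain n j : (d - j < n)%N -> (j <= d)%N -> nz j ->
    (exists s : rat, forall i, (i <= d)%N -> nz i ->
        (w j)%:R + s * (i%:R - j%:R) <= (w i)%:R) ->
    proportional (7 + m) (lead j) (lead d).
  apply: (chain d.+1) => //; first by rewrite subn0.
  (* This slope is steep enough: at every i > 0 the line is already at or below zero. *)
  exists (- (w 0%N)%:R) => -[_ _|i _ _]; first by rewrite subrr mulr0 addr0.
  apply: le_trans (ler0n _ _); rewrite subr0 mulNr subr_le0 ler_peMr ?ler0n //.
  by rewrite ler1n.
elim: n j => // n IH j lt_n le_jd nzj [s s_le].
move: le_jd; rewrite leq_eqVlt => /orP[/eqP jd|lt_jd].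
  by rewrite jd; exists 1 => [|i _]; rewrite ?oner_eq0 ?mul1r.
pose slope (i : 'I_d.+1) : rat := ((w i)%:R - (w j)%:R) / (i%:R - j%:R).
pose P (i : 'I_d.+1) := (j < i)%N && nz i.
have Pd : P ord_max by rewrite /P lt_jd.
(* The next vertex i minimizes the slope among the points to the right of j, so the line through j
   and i is again a supporting line. *)
case: (arg_minP slope Pd) => i /andP[lt_ji nzi] i_min.
have ij0 (l : nat) : (j < l)%N -> 0 < l%:R - j%:R :> rat.
  by rewrite subr_gt0 ltr_nat.
have le_id : (i <= d)%N by rewrite -ltnS.
have slopeE : slope i * (i%:R - j%:R) = (w i)%:R - (w j)%:R.
  by rewrite /slope divfK // gt_eqF // ij0.
have s_slope : s <= slope i by rewrite /slope ler_pdivlMr ?ij0 //; have := s_le i le_id nzi; lra.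
have line l : (l <= d)%N -> nz l -> (w j)%:R + slope i * (l%:R - j%:R) <= (w l)%:R.
  move=> le_ld nzl; have [lt_jl|le_lj] := ltnP j l.
    have lt_ld : (l < d.+1)%N by [].
    have := i_min (Ordinal lt_ld); rewrite /P /= lt_jl nzl => /(_ isT).
    by rewrite {2}/slope ler_pdivlMr ?ij0 //=; lra.
  have := s_le l le_ld nzl; apply: le_trans; rewrite lerD2l.
  by rewrite ler_wnM2r // subr_le0 ler_nat.
apply: (@proportional_trans _ _ (lead i)); last first.
  apply: IH => //; first lia.
  exists (slope i) => l le_ld nzl; have := line l le_ld nzl.
  apply: le_trans; rewrite le_eqVlt; apply/orP; left; apply/eqP.
  have -> : (w i)%:R = (w j)%:R + slope i * (i%:R - j%:R) by rewrite slopeE; ring.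
  ring.
have valE l : (l <= d)%N -> ((i - j) * w l + w j * l + w i * (d - l))%:R =
    (i%:R - j%:R) * (w l)%:R + (w j)%:R * l%:R + (w i)%:R * (d%:R - l%:R) :> rat.
  by move=> le_ld; rewrite !natrD !natrM !natrB // ltnW.
(* The equation of the edge is multiplied by i - j; distributing w j and w i over u and v, instead
   of using their difference, keeps all exponents in nat. *)
apply: (@edge_proportional (i - j) (w j) (w i)
  ((i - j) * w j + w j * j + w i * (d - j))%N); rewrite ?subn_gt0 //; try lia.
- move=> l le_ld nzl; rewrite -(ler_nat rat) !valE //; last exact: ltnW.
  have := ler_wpM2l (ltW (ij0 i lt_ji)) (line l le_ld nzl).
  rewrite mulrDr [_ * (slope i * _)]mulrA [_ * slope i]mulrC slopeE; lra.
- apply/eqP; rewrite -(eqr_nat rat) !valE //; last exact: ltnW.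
  by apply/eqP; ring.
Qed.

End NewtonChain.

(** * Specialization of points over Q(t) *)

Lemma fraction_numden (R : idomainType) (x : {fraction R}) :
  exists n, exists2 d, d != 0 & x = tofrac n / tofrac d.
Proof.
have -> : x = (\pi_(FracField.type R) (repr x))%qT by rewrite reprK.
set y := repr x; have dy := denom_ratioP y; exists \n_y, \d_y => //.
apply: (canRL (mulfK _)); first by rewrite tofrac_eq0.
rewrite -[LHS]/(FracField.mul _ _) !piE; apply/eqmodP.
rewrite /= FracField.equivfE /FracField.mulf !numden_Ratio ?mulf_neq0 ?oner_eq0 //.
by rewrite !mulr1 mulrC.
Qed.

Lemma common_denominator (R : idomainType) (s : seq {fraction R}) :
  exists2 d : R, d != 0 & forall x, x \in s -> exists a, tofrac a = tofrac d * x.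
Proof.
elim: s => [|x s [d d0 ds]]; first by exists 1; rewrite ?oner_eq0.
have [n [e e0 xE]] : exists n, exists2 d, d != 0 & x = tofrac n / tofrac d.
  exact: fraction_numden.
have e0F : tofrac e != 0 by rewrite tofrac_eq0.
exists (d * e) => [|y]; first by rewrite mulf_neq0.
rewrite inE => /orP[/eqP ->|/ds[a aE]].
  by exists (d * n); rewrite xE !rmorphM /= -mulrA [_ * (_ / _)]mulrC divfK.
by exists (a * e); rewrite !rmorphM /= aE mulrAC.
Qed.

Definition mono2 d i : 'X_{1..2} := (U_(0%R : 'I_2) *+ i + U_(1%R : 'I_2) *+ (d - i))%MM.

Lemma homog2E (R : comNzRingType) d (p : {mpoly R[2]}) : p \is d.-homog ->
  p = \sum_(i < d.+1) (p@_(mono2 d i))%:MP * 'X_0 ^+ i * 'X_1 ^+ (d - i).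
Proof.
move=> hp; apply/mpolyP => k; rewrite raddf_sum /=.
under eq_bigr => i _ do
  rewrite -mulrA !mpolyXn -mpolyXD mcoeffCM mcoeffX -/(mono2 d i).
have mono0 i : (mono2 d i 0%R = i)%N by rewrite mnmDE !mulmnE !mnm1E /= mul1n mul0n addn0.
have mono1 i : (mono2 d i 1%R = d - i)%N by rewrite mnmDE !mulmnE !mnm1E /= mul1n mul0n.
have [kd|kd] := eqVneq (mdeg k) d; last first.
  rewrite (dhomog_nemf_coeff hp kd) big1 // => i _.
  case: eqP => [ki|]; last by rewrite mulr0.
  by rewrite ki (dhomog_nemf_coeff hp kd) mul0r.
have kE : k = mono2 d (k 0).
  move: kd; rewrite mdegE !big_ord_recl big_ord0 addn0 => kd.
  apply/mnmP => -[[|[|//]] lt_j].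
    by rewrite (_ : Ordinal lt_j = 0) ?mono0 //; apply: val_inj.
  rewrite (_ : Ordinal lt_j = 1) ?mono1 -?kd ?addKn; last exact: val_inj.
  by congr (k _); apply: val_inj.
have lt_k : (k 0%R < d.+1)%N by rewrite -kd mdegE big_ord_recl ltnS leq_addr.
rewrite (bigD1 (Ordinal lt_k)) //= -kE eqxx mulr1 big1 ?addr0 // => i ik.
case: eqP => [ki|]; last by rewrite mulr0.
by case/eqP: ik; apply: val_inj; rewrite /= -ki mono0.
Qed.

(** All reductions at t = 0 of polynomial vectors on the line P. Being a set, it needs no choice of
    a primitive vector; [specialization_line] shows that it is the line of the reduction. *)
Definition specialization k (P : {vspace 'rV[Qt]_k}) : set 'rV[rat]_k :=
  [set u | exists2 a : 'rV[{poly rat}]_k, map_mx (@tofrac _) a \in P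
     & u = map_mx (horner_eval 0) a]%classic.

Lemma specialization_line k (c : Qt) (b : 'rV[{poly rat}]_k) :
  c != 0 -> map_mx (horner_eval 0) b != 0 ->
  specialization <[c *: map_mx (@tofrac _) b]>%VS =
  [set u | exists r : rat, u = r *: map_mx (horner_eval 0) b]%classic.
Proof.
move=> c0 b0; apply/seteqP; split=> u /=; last first.
  move=> [r ->]; exists (r%:P *: b); last first.
    by apply/rowP => i; rewrite !mxE /horner_eval hornerM hornerC.
  apply/vlineP; exists (tofrac r%:P / c); rewrite scalerA divfK //.
  by apply/rowP => i; rewrite !mxE rmorphM.
move=> [a /vlineP[l]]; rewrite scalerA => abE ->.
have [n [d d0 lE]] : exists n, exists2 d, d != 0 & l * c = tofrac n / tofrac d.
  exact: fraction_numden.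
have [w [q [qE q0]]] := poly_mulX_fact (fun j => if j == 0%N then n else d) 2.
have [nE dE] : n = 'X^w * q 0%N /\ d = 'X^w * q 1%N by split; rewrite -?(qE 0%N) -?(qE 1%N).
have abE' i : q 1%N * a 0 i = q 0%N * b 0 i.
  apply: (mulfI (x := 'X^w)); first by rewrite -size_poly_gt0 size_polyXn.
  apply/eqP; rewrite !mulrA -nE -dE -tofrac_eq !rmorphM /=.
  have := congr1 (fun v : 'rV[Qt]_k => v 0 i) abE; rewrite !mxE lE => ->.
  by rewrite mulrA [tofrac d * _]mulrC divfK ?tofrac_eq0.
have ev i : (q 1%N).[0] * (a 0 i).[0] = (q 0%N).[0] * (b 0 i).[0].
  by rewrite -!hornerM abE'.
(* If q1 vanished at 0, so would q0, as b does not reduce to zero; but the common power of X has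
   been removed from the pair. *)
have q10 : (q 1%N).[0] != 0.
  have [|j lt_j qj] := q0; first by exists 1%N.
  apply: contraNneq b0 => q10; apply/eqP/rowP => i; rewrite !mxE /horner_eval.
  have := ev i; rewrite q10 mul0r => /esym/eqP; rewrite mulf_eq0 => /orP[/eqP q00|/eqP //].
  by move: lt_j qj; case: j => [|[|//]] _; rewrite ?q00 ?q10 eqxx.
exists ((q 0%N).[0] / (q 1%N).[0]); apply/rowP => i; rewrite !mxE /horner_eval.
by apply: (mulfI q10); rewrite ev mulrA [_ * (_ / _)]mulrC divfK.
Qed.

Lemma map_mpoly_id (R : nzRingType) n (p : {mpoly R[n]}) : map_mpoly idfun p = p.
Proof. by apply/mpolyP => k; rewrite mcoeff_map_mpoly. Qed.

Lemma map_mpoly_inj (R S : nzRingType) (f : {rmorphism R -> S}) n :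
  injective f -> injective (map_mpoly f : {mpoly R[n]} -> {mpoly S[n]}).
Proof.
move=> f_inj p q /mpolyP pq; apply/mpolyP => k; apply: f_inj.
by have := pq k; rewrite !mcoeff_map_mpoly.
Qed.

Lemma tofrac_inj (R : idomainType) : injective (@tofrac R).
Proof. by move=> p q /eqP; rewrite tofrac_eq => /eqP. Qed.

Definition frac_t : Qt := tofrac ('X : {poly rat}).

Lemma homog2_eval (R : comNzRingType) d (p : {mpoly R[2]}) (y : 'I_2 -> R) :
  p \is d.-homog -> p.@[y] = \sum_(i < d.+1) p@_(mono2 d i) * y 0 ^+ i * y 1 ^+ (d - i).
Proof.
move=> hp; rewrite {1}(homog2E hp) raddf_sum; apply: eq_bigr => i _ /=.
by rewrite !mevalM mevalC !rmorphXn /= !mevalXU.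
Qed.

(** The two end points of a direct R-equivalence are the extreme coefficient vectors of p, and
    [newton_chain] makes their reductions proportional. *)
Lemma R_equivalent_specialization m (P1 P2 : {vspace 'rV[Qt]_m.+4.+3}) :
  directly_R_equivalent (quartic_form m frac_t) P1 P2 ->
  specialization P1 = specialization P2.
Proof.
case=> p [[[d hd] nz_p fp] <- <-].
pose co i j : Qt := (tnth p (inord j))@_(mono2 d i).
have [D D0 dens] := common_denominator
  [seq co i j | i <- iota 0 d.+1, j <- iota 0 (7 + m)].
(* Each coefficient vector, after the common denominator D is cleared, is a power of t times a
   vector that is zero or has nonzero reduction. *)
have /choice[wB wBE] : forall i, exists wb : nat * (nat -> {poly rat}), (i <= d)%N ->
    [/\ forall j, (j < 7 + m)%N -> tofrac ('X^(wb.1) * wb.2 j) = tofrac D * co i j,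
        (exists2 j, (j < 7 + m)%N & co i j != 0) ->
          exists2 j, (j < 7 + m)%N & (wb.2 j).[0] != 0
      & ~ (exists2 j, (j < 7 + m)%N & (wb.2 j).[0] != 0) -> forall j, wb.2 j = 0].
  move=> i; have [le_id|] := boolP (i <= d)%N; last by exists (0%N, fun=> 0).
  have /choice[A AE] : forall j, exists a, (j < 7 + m)%N -> tofrac a = tofrac D * co i j.
    move=> j; have [lt_j|] := boolP (j < 7 + m)%N; last by exists 0.
    have [|a aE] := dens (co i j); last by exists a.
    by apply/allpairsP; exists (i, j); split; rewrite // mem_iota.
  have A0 j : (j < 7 + m)%N -> co i j != 0 -> A j != 0.
    move=> lt_j; apply: contraNneq => Aj; have := AE j lt_j; rewrite Aj rmorph0.
    by move/esym/eqP; rewrite mulf_eq0 tofrac_eq0 (negPf D0).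
  have [w [b [bE b0]]] := poly_mulX_fact A (7 + m).
  exists (w, fun j => if (j < 7 + m)%N then b j else 0) => _; split=> /=.
  - by move=> j lt_j; rewrite lt_j -bE // AE.
  - by case=> j lt_j /A0 Aj; case: b0 => [|l lt_l]; [exists j; rewrite ?Aj | exists l; rewrite ?lt_l].
  - move=> b00 j; case: ifP => // lt_j; apply/eqP/negP => /negP bj; case: b00.
    case: b0 => [|l lt_l bl]; last by exists l; rewrite ?lt_l.
    by exists j; rewrite // bE // mulf_neq0 // -size_poly_gt0 size_polyXn.
pose w i := (wB i).1; pose B i := (wB i).2.
have coE i j : (i <= d)%N -> (j < 7 + m)%N -> tofrac ('X^(w i) * B i j) = tofrac D * co i j.
  by move=> /wBE[+ _ _]; apply.
have curve (R : comNzRingType) (phi : {rmorphism {poly rat} -> R}) (u v : R) :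
    quartic m (phi 'X) (fun j => \sum_(i < d.+1)
      phi ('X^(w i) * B i j) * u ^+ i * v ^+ (d - i)) = 0.
  pose x j : {mpoly {poly rat}[2]} :=
    \sum_(i < d.+1) ('X^(w i) * B i j)%:MP * 'X_0 ^+ i * 'X_1 ^+ (d - i).
  have x0 : quartic m ('X)%:MP x = 0.
    apply: (map_mpoly_inj (@tofrac_inj _)); rewrite rmorph0.
    rewrite [LHS](quartic_morph (map_mpoly (@tofrac _))) /= map_mpolyC quartic_inord.
    rewrite (_ : (fun _ => _) = fun j => (tofrac D)%:MP * tnth p (inord j)).
      rewrite quartic_scale; have := quartic_form_comp frac_t p.
      by rewrite fp => <-; rewrite mulr0.
    apply/funext => j /=; rewrite (homog2E (hd (inord j))) mulr_sumr raddf_sum.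
    apply: eq_bigr => i _ /=; rewrite 2!rmorphM 2!rmorphXn /= map_mpolyC !map_mpolyX.
    transitivity ((tofrac D * co i (@inord m.+4.+2 j))%:MP * 'X_0 ^+ i * 'X_1 ^+ (d - i) : {mpoly Qt[2]}).
      have le_id : (i <= d)%N by rewrite -ltnS.
      by rewrite -(coE i _ le_id (ltn_ord _)).
    by rewrite /co inord_val rmorphM /= !mulrA.
  have := quartic_morph (mmap phi (fun i : 'I_2 => if i == 0 then u else v)) m ('X)%:MP x.
  rewrite x0 rmorph0 /= mmapC => /esym xE; rewrite -[RHS]xE; congr (quartic _ _ _).
  apply/funext => j /=; rewrite /x raddf_sum; apply: eq_bigr => i _ /=.
  by rewrite [RHS]rmorphM [X in _ = X * _]rmorphM 2!rmorphXn /= mmapC !mmapX !mmap1U.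
(* This will be used at (0 : 1) with i = 0 and at (1 : 0) with i = d; the coefficient vectors there
   are nonzero because p has no base point. *)
have endpoint (y : 'rV[Qt]_2) i : (i <= d)%N -> y != 0 ->
    (forall j, eval_forms idfun p y 0 (inord j) = co i j) ->
  nz m B i /\ specialization <[eval_forms idfun p y]>%VS =
    [set u | exists r : rat, u = r *: \row_(j < m.+4.+3) lead B i j]%classic.
  move=> le_id y0 yE; have [_ nzE _] := wBE i le_id.
  have nzi : nz m B i.
    apply/asboolP; apply: nzE; apply: contrapT => co0; have /eqP := nz_p _ idfun y y0.
    apply; apply/rowP => j; rewrite -[j]inord_val yE mxE; apply/eqP/negP => /negP nzj.
    by apply: co0; exists (j : nat); rewrite // ltn_ord.
  split=> //; have D0F : tofrac D != 0 by rewrite tofrac_eq0.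
  pose b := \row_(j < m.+4.+3) B i j.
  have bE : map_mx (horner_eval 0) b = \row_(j < m.+4.+3) lead B i j.
    by apply/rowP => j; rewrite !mxE.
  have -> : eval_forms idfun p y = (tofrac D)^-1 * tofrac 'X^(w i) *: map_mx (@tofrac _) b.
    apply/rowP => j; rewrite -{1}[j]inord_val yE !mxE -mulrA -tofracM coE //.
    by rewrite mulKf.
  rewrite specialization_line ?bE ?mulf_neq0 ?invr_eq0 ?tofrac_eq0 //.
    exact: monic_neq0 (monicXn _ _).
  have /asboolP[j lt_j lj] := nzi; apply: contraNneq lj.
  by move=> /(congr1 (fun v : 'rV[rat]_m.+4.+3 => v 0 (Ordinal lt_j))); rewrite !mxE => /eqP.
have homog_eval (y : 'rV[Qt]_2) j : eval_forms idfun p y 0 (inord j) =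
    \sum_(i < d.+1) co i j * y 0 0 ^+ i * y 0 1 ^+ (d - i).
  by rewrite mxE map_mpoly_id (homog2_eval _ (hd _)).
have delta01 : delta_mx 0 1 != 0 :> 'rV[Qt]_2.
  by apply/eqP => /rowP/(_ 1); rewrite !mxE /= => /eqP; rewrite oner_eq0.
have delta00 : delta_mx 0 0 != 0 :> 'rV[Qt]_2.
  by apply/eqP => /rowP/(_ 0); rewrite !mxE /= => /eqP; rewrite oner_eq0.
have [|nz0 spec0] := endpoint (delta_mx 0 1) 0%N isT delta01.
  move=> j; rewrite homog_eval big_ord_recl /= !mxE /= expr1n !mulr1 big1 ?addr0 // => i _.
  by rewrite expr0n mulr0 mul0r.
have [|nzd specd] := endpoint (delta_mx 0 0) d (leqnn d) delta00.
  move=> j; rewrite homog_eval big_ord_recr /= !mxE /= subnn expr1n !mulr1.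
  by rewrite big1 ?add0r // => i _; rewrite expr0n subn_eq0 leqNgt ltn_ord mulr0.
have B0 i : (i <= d)%N -> ~~ nz m B i -> forall j, B i j = 0.
  by move=> le_id /asboolPn ?; have [_ _] := wBE i le_id; apply.
have [c c0 cE] := newton_chain curve B0 nz0 nzd.
have rowE : \row_(j < m.+4.+3) lead B d j = c *: \row_(j < m.+4.+3) lead B 0 j.
  by apply/rowP => j; rewrite !mxE cE.
rewrite /P1_image spec0 specd rowE; apply/seteqP; split=> u /= [r ->].
  by exists (r / c); rewrite scalerA divfK.
by exists (r * c); rewrite scalerA.
Qed.

(* The points of the curve e^2 = a^2 + 5 b^2, g^2 = a^2 - 5 b^2 obtained from
   (41 : 12 : 49 : 31) by repeated doubling. *)
Fixpoint doubling n : int * int * int * int :=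
  if n is n'.+1 then
    let: (a, b, e, g) := doubling n' in
    (a ^+ 4 + 25 * b ^+ 4, 2 * a * b * e * g,
     a ^+ 4 + 10 * a ^+ 2 * b ^+ 2 - 25 * b ^+ 4,
     a ^+ 4 - 10 * a ^+ 2 * b ^+ 2 - 25 * b ^+ 4)
  else (41, 12, 49, 31).

Lemma doublingP n : let: (a, b, e, g) := doubling n in
  e ^+ 2 = a ^+ 2 + 5 * b ^+ 2 /\ g ^+ 2 = a ^+ 2 - 5 * b ^+ 2.
Proof.
elim: n => [//|n] /=; case: (doubling n) => [[[a b] e] g] [eE gE].
split.
  transitivity ((a ^+ 4 + 25 * b ^+ 4) ^+ 2 + 20 * a ^+ 2 * b ^+ 2 *
    ((a ^+ 2 + 5 * b ^+ 2) * (a ^+ 2 - 5 * b ^+ 2))); first ring.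
  by rewrite -eE -gE; ring.
transitivity ((a ^+ 4 + 25 * b ^+ 4) ^+ 2 - 20 * a ^+ 2 * b ^+ 2 *
  ((a ^+ 2 + 5 * b ^+ 2) * (a ^+ 2 - 5 * b ^+ 2))); first ring.
by rewrite -eE -gE; ring.
Qed.

(** Doubling multiplies b by 2 a e g with a, e, g odd, so the 2-adic valuation of b grows by one
    each time. This separates the points. *)
Lemma doubling_logn n : let: (a, b, e, g) := doubling n in
  [/\ odd `|a|, odd `|e|, odd `|g|, (0 < `|b|)%N & logn 2 `|b| = n.+2].
Proof.
elim: n => [//|n] /=; case: (doubling n) => [[[a b] e] g] [oa oe og b0 lb].
have eb : ~~ odd `|b|.
  rewrite -dvdn2; have := pfactor_dvdnn 2 `|b|; rewrite lb; apply: dvdn_trans.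
  by rewrite expnS dvdn_mulr.
have oddD (x y : int) : odd `|x + y| = odd `|x| (+) odd `|y| by case: x => ?; case: y => ?; lia.
have odd_gt0 x : odd x -> (0 < x)%N by case: x.
have simp := (oddD, abszN, abszM, abszX, oddM, oddX, oa, negPf eb).
split; [by rewrite !simp | by rewrite !simp | by rewrite !simp | |]; rewrite !abszM -[`|2%R|%N]/2%N.
  by rewrite !muln_gt0 b0 (odd_gt0 _ oa) (odd_gt0 _ oe) (odd_gt0 _ og).
rewrite !lognM ?muln_gt0 ?b0 ?(odd_gt0 _ oa) ?(odd_gt0 _ oe) ?(odd_gt0 _ og) // lb.
have log0 x : odd x -> logn 2 x = 0%N.
  by move=> ox; rewrite lognE /= dvdn2 ox /= andbF.
by rewrite (log0 _ oa) (log0 _ oe) (log0 _ og) !addn0 (_ : logn 2 2 = 1%N).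
Qed.

(** * From distinct specializations to infinitely many classes *)

Lemma infinite_set_nat_inj T (A : set T) (f : nat -> T) :
  injective f -> (forall n, A (f n)) -> infinite_set A.
Proof.
move=> f_inj fA finA; apply: infinite_nat.
apply: (@sub_finite_set _ _ (f @^-1` A)%classic) => [n _|]; first exact: fA.
by apply: finite_preimage => // x y _ _; exact: f_inj.
Qed.

Lemma infinite_R_classes_invariant k (f : {mpoly Qt[k]}) (T : Type)
    (inv : {vspace 'rV[Qt]_k} -> T) (P : nat -> {vspace 'rV[Qt]_k}) :
  (forall P1 P2, directly_R_equivalent f P1 P2 -> inv P1 = inv P2) ->
  (forall n, rational_points f (P n)) -> injective (inv \o P) ->
  infinite_set (R_classes f).
Proof.
move=> inv_eq fP inv_inj.
have R_inv P1 P2 : R_equivalent f P1 P2 -> inv P1 = inv P2.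
  by elim=> // ? ? ? _ -> _ ->.
pose C n := [set Q | rational_points f Q /\ R_equivalent f (P n) Q]%classic.
apply: (@infinite_set_nat_inj _ _ C) => [n1 n2 C12|n]; last by exists (P n).
have : C n1 (P n1) by split=> //; exact: rst_refl.
by rewrite C12 => -[_ /R_inv /esym] /inv_inj.
Qed.

(** The lift of a point of the curve: the fourth coordinate t a makes [quad0] vanish, and the rest
    of the quartic is zero by the relations of the curve. *)
Definition special_point m n : 'rV[{poly rat}]_m.+4.+3 :=
  let: (a, b, e, g) := doubling n in
  let c (z : int) : {poly rat} := z%:~R in
  \row_i nth 0 [:: c a; 0; 0; 'X * c a; c b; c e; c g] i.

Lemma quartic_special_point m n :
  quartic m 'X (fun i => special_point m n 0 (inord i)) = 0.
Proof.
rewrite /special_point; have := doublingP n; case: (doubling n) => [[[a b] e] g] [eE gE].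
set x := nth 0 _; transitivity (quartic m 'X x).
  rewrite [RHS]quartic_inord; congr (quartic _ _ _).
  by apply/funext => i; rewrite mxE.
have cast (y z : int) : z ^+ 2 = y -> (z%:~R : {poly rat}) ^+ 2 = y%:~R.
  by move=> <-; rewrite !expr2 rmorphM.
have {}eE : x 5%N ^+ 2 = x 0%N ^+ 2 + 5 * x 4%N ^+ 2.
  by rewrite /x /= (cast _ _ eE) rmorphD !expr2 !rmorphM.
have {}gE : x 6%N ^+ 2 = x 0%N ^+ 2 - 5 * x 4%N ^+ 2.
  by rewrite /x /= (cast _ _ gE) rmorphB !expr2 !rmorphM.
have q1 : quad1 x = 0 by rewrite /quad1 eE; ring.
have q2 : quad2 x = 0 by rewrite /quad2 gE; ring.
rewrite /quartic /residual q1 q2.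
have -> : tail4 m x = 0.
  by apply: big1 => i _; rewrite /x nth_default ?expr0n // leq_addr.
rewrite (_ : x 5%N ^+ 4 = (x 0%N ^+ 2 + 5 * x 4%N ^+ 2) ^+ 2); last by rewrite -eE; ring.
rewrite (_ : x 6%N ^+ 4 = (x 0%N ^+ 2 - 5 * x 4%N ^+ 2) ^+ 2); last by rewrite -gE; ring.
by rewrite /quad0 /x /=; ring.
Qed.

Lemma special_point_nz m n : map_mx (horner_eval 0) (special_point m n) != 0.
Proof.
apply/eqP => /(congr1 (fun v : 'rV[rat]_m.+4.+3 => v 0 (inord 4))).
rewrite /special_point; have := doubling_logn n.
case: (doubling n) => [[[a b] e] g] [_ _ _ b0 _].
rewrite !mxE inordK //= /horner_eval -(rmorph_int polyC) hornerC => /eqP.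
by rewrite intr_eq0 -absz_eq0 eqn0Ngt b0.
Qed.

Lemma infinite_R_classes m : infinite_set (R_classes (quartic_form m frac_t)).
Proof.
pose P n : {vspace 'rV[Qt]_m.+4.+3} := <[1 *: map_mx (@tofrac _) (special_point m n)]>%VS.
apply: (@infinite_R_classes_invariant _ _ _ (@specialization _) P).
- exact: R_equivalent_specialization.
- move=> n; split.
    rewrite dim_vline scale1r; case: eqP => // v0.
    case/eqP: (special_point_nz m n); apply/rowP => i; rewrite !mxE.
    have := congr1 (fun v : 'rV[Qt]_m.+4.+3 => v 0 i) v0; rewrite !mxE => /eqP.
    by rewrite tofrac_eq0 => /eqP ->; rewrite /horner_eval horner0.
  move=> v /vlineP[c ->]; rewrite scale1r meval_quartic_form.
  under [fun i => _]funext do rewrite !mxE.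
  rewrite quartic_scale; have := quartic_morph (@tofrac {poly rat}) m 'X
    (fun i => special_point m n 0 (inord i)).
  by rewrite quartic_special_point rmorph0 => <-; rewrite mulr0.
move=> n1 n2 /=; rewrite !specialization_line ?oner_eq0 ?special_point_nz // => E12.
have : [set u | exists r : rat, u = r *: map_mx (horner_eval 0) (special_point m n2)]%classic
    (map_mx (horner_eval 0) (special_point m n1)).
  by rewrite -E12; exists 1; rewrite scale1r.
case=> r /rowP rE; have := rE (inord 0); have := rE (inord 4).
rewrite /special_point; have := doubling_logn n1; have := doubling_logn n2.
case: (doubling n1) => [[[a b] e] g]; case: (doubling n2) => [[[a' b'] e'] g'].
move=> [oa' _ _ b'0 lb'] [oa _ _ b0 lb].
rewrite !mxE !inordK //= /horner_eval -!(rmorph_int polyC) !hornerC => bE aE.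
(* Since a and a' are odd, the 2-adic valuations of the two sides are n2 + 2 and n1 + 2. *)
have /(congr1 (fun z : int => logn 2 `|z|)) : a * b' = a' * b.
  by apply/eqP; rewrite -(eqr_int rat) !rmorphM /= bE aE; apply/eqP; ring.
have odd_gt0 x : odd x -> (0 < x)%N by case: x.
have log0 x : odd x -> logn 2 x = 0%N.
  by move=> ox; rewrite lognE /= dvdn2 ox /= andbF.
rewrite !abszM !lognM ?(odd_gt0 _ oa) ?(odd_gt0 _ oa') // (log0 _ oa) (log0 _ oa') lb lb' => -[].
by move=> ->.
Qed.

(** * Places *)

Section ValuationRing.
Local Open Scope classical_set_scope.
Variables (L : fieldType) (S0 : set L) (pi : L).

Definition subring_set (S : set L) :=
  [/\ S 1, forall x y, S x -> S y -> S (x - y) & forall x y, S x -> S y -> S (x * y)].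

Hypotheses (S0_ring : subring_set S0) (S0_pi : S0 pi).
Hypothesis pi_nonunit : forall s, S0 s -> s * pi != 1.

Lemma subring_setD S x y : subring_set S -> S x -> S y -> S (x + y).
Proof.
move=> [S1 SB _] Sx Sy; rewrite -[y]opprK; apply: (SB) => //.
by rewrite -sub0r -(subrr 1); apply: (SB) => //; apply: (SB).
Qed.

Let good S := [/\ subring_set S, S0 `<=` S & forall s, S s -> s * pi != 1].

Lemma maximal_nonunit_subring :
  exists S, good S /\ forall S', good S' -> S `<=` S' -> S' `<=` S.
Proof.
have [|A [[A0|goodA] maxA]] := @Zorn_bigcup L [set S | S = set0 \/ good S].
- move=> F FP totF; have [[X FX goodX]|no_good] := pselect (exists2 X, F X & good X).
    right; have FE (x y : L) : (\bigcup_(Y in F) Y) x -> (\bigcup_(Y in F) Y) y ->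
        exists2 Y, F Y & [/\ good Y, Y x & Y y].
      move=> [Y FY Yx] [Z FZ Zy].
      have good_of W w : F W -> W w -> good W.
        by move=> /FP[->|].
      have [YZ|ZY] := totF _ _ FY FZ.
        by exists Z => //; split; [exact: good_of Zy | exact: YZ|].
      by exists Y => //; split; [exact: good_of Yx | | exact: ZY].
    have [[X1 _ _] S0X _] := goodX.
    split; last by move=> s Us; have [Y FY [[_ _ +] Ys _]] := FE s s Us Us; apply.
      split; first by exists X.
        move=> x y Ux Uy; have [Y FY [[[_ SB _] _ _] Yx Yy]] := FE x y Ux Uy.
        by exists Y => //; apply: (SB).
      move=> x y Ux Uy; have [Y FY [[[_ _ SM] _ _] Yx Yy]] := FE x y Ux Uy.
      by exists Y => //; apply: (SM).
    by move=> s /S0X Xs; exists X.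
  left; apply/seteqP; split=> // x [X FX Xx].
  by case: (FP _ FX) => [X0|gX]; [rewrite X0 in Xx | case: no_good; exists X].
- have goodS0 : good S0 by split.
  case: (maxA S0); last by right.
  rewrite A0; split=> // S00; have [S1 _ _] := S0_ring; exact: S00 S1.
- exists A; split=> // S goodS AS; apply: contrapT => nSA.
  by case: (maxA S); [split | right].
Qed.

(** Chevalley's extension theorem: a subring maximal among those in which pi stays a non-unit is a
    valuation ring. *)
Lemma valuation_ring_exists : exists V : set L,
  [/\ subring_set V, S0 `<=` V, forall x, V x \/ V x^-1 & forall v, V v -> v * pi != 1].
Proof.
have [S [[Sring S0S Spi] maxS]] := maximal_nonunit_subring.
exists S; split=> //; have [S1 SB SM] := Sring.
have SD x y : S x -> S y -> S (x + y) by exact: subring_setD.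
have S0' : S 0 by rewrite -(subrr 1); apply: (SB).
have Spi' : S pi by apply: S0S.
have SX x n : S x -> S (x ^+ n) by move=> Sx; elim: n => // n; rewrite exprS; apply: (SM).
pose coefs (p : {poly L}) := forall i, S p`_i.
have Ssum n (F : 'I_n -> L) : (forall i, S (F i)) -> S (\sum_i F i).
  by move=> SF; elim/big_ind: _ => // i _.
(* Maximality: adjoining y outside S makes pi invertible *)
have adjoin y : ~ S y -> exists2 p, coefs p & p.[y] * pi = 1.
  move=> nSy; pose Sy := [set z | exists2 p, coefs p & p.[y] = z].
  have SSy : S `<=` Sy.
    move=> s Ss; exists s%:P; rewrite ?hornerC // => i; rewrite coefC.
    by case: eqP.
  have SyR : subring_set Sy.
    split; first exact: SSy.
      move=> _ _ [p Sp <-] [q Sq <-]; exists (p - q); rewrite ?hornerD ?hornerN // => i.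
      by rewrite coefB; apply: (SB).
    move=> _ _ [p Sp <-] [q Sq <-]; exists (p * q); rewrite ?hornerM // => i.
    by rewrite coefM; apply: (Ssum) => j; apply: (SM).
  apply: contrapT => no_p; case: nSy; apply: (maxS Sy) => //; last first.
    exists 'X; rewrite ?hornerX // => i; rewrite coefX; case: eqP => //.
  split=> //; first exact: subset_trans SSy.
  by move=> _ [p Sp <-]; apply/eqP => p1; apply: no_p; exists p.
(* If 1/u were outside S, maximality would give p(1/u) pi = 1; clearing denominators by u^(size p),
   which has the form 1 - pi r, would make pi invertible in S. *)
have unit1 s : S s -> 1 - pi * s != 0 /\ S (1 - pi * s)^-1.
  move=> Ss; set u := 1 - pi * s.
  have u0 : u != 0.
    by apply/eqP => /subr0_eq/esym/eqP; rewrite mulrC (negPf (Spi _ Ss)).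
  split=> //; apply: contrapT => /adjoin[p Sp p1].
  have Su : S u by apply: (SB) => //; apply: (SM).
  have uX n : exists2 r, S r & u ^+ n = 1 - pi * r.
    elim: n => [|n [r Sr uE]]; first by exists 0; rewrite ?mulr0 ?subr0.
    exists (s + r - pi * (s * r)); last by rewrite exprS uE /u; ring.
    by apply: (SB); [apply: (SD) | apply: (SM) => //; apply: (SM)].
  have [r Sr uE] := uX (size p).
  have [q Sq qE] : exists2 q, S q & u ^+ (size p) * p.[u^-1] = q.
    eexists; last reflexivity.
    rewrite horner_coef mulr_sumr; apply: (Ssum) => i.
    rewrite mulrCA exprVn -expfB // ?ltn_ord //; apply: (SM) => //; exact: SX.
  have := Spi (q + r) (SD _ _ Sq Sr); rewrite mulrDl -qE -mulrA p1 mulr1 uE.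
  by rewrite mulrC subrK eqxx.
(* The two relations 1 = pi p(y), 1 = pi q(1/y) of lowest degrees reduce each other *)
have reduce n : forall y p q, coefs p -> coefs q -> (size p + size q <= n)%N ->
    p.[y] * pi = 1 -> q.[y^-1] * pi = 1 -> y != 0 -> False.
  elim: n => [|n IH] y p q Sp Sq.
    rewrite leqn0 addn_eq0 size_poly_eq0 => /andP[/eqP -> _].
    by rewrite horner0 mul0r => /esym/eqP; rewrite oner_eq0.
  wlog le_qp : y p q Sp Sq / (size q <= size p)%N.
    move=> wl le_n pE qE y0; case: (leqP (size q) (size p)) => [le|/ltnW le].
      exact: (wl y p q).
    by apply: (wl y^-1 q p) => //; rewrite ?invrK ?invr_eq0 // addnC.
  move=> le_n pE qE y0.
  have [sp|sp] := leqP (size p) 1.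
    have := Spi _ (Sp 0%N); rewrite (size1_polyC sp) hornerC in pE.
    by rewrite pE eqxx.
  have [u0 Su] := unit1 _ (Sq 0%N); set u := 1 - pi * q`_0 in u0 Su.
  pose d := (size p).-2.
  have sizeE : size p = d.+2 by rewrite /d; case: (size p) sp => [|[]].
  (* The relation for q reads u = pi (q_1 / y + q_2 / y^2 + ...). Multiplied by y^(d+1) / u it
     expresses y^(d+1) as pi q'(y) with q' of degree at most d, and this replaces the top term of
     p. *)
  pose q' := \poly_(i < d.+1) (if (d - i < (size q).-1)%N then u^-1 * q`_(d - i).+1 else 0).
  have q'E : pi * q'.[y] = y ^+ d.+1.
    have Su' : u = pi * \sum_(j < d.+1) q`_j.+1 * y^-1 ^+ j.+1.
      have : q.[y^-1] = q`_0 + \sum_(j < d.+1) q`_j.+1 * y^-1 ^+ j.+1.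
        have sq : (size q <= d.+2)%N by rewrite -sizeE.
        by rewrite (horner_coef_wide _ sq) big_ord_recl expr0 mulr1.
      by rewrite /u -qE => ->; ring.
    rewrite horner_poly -[RHS](mulKf u0) [X in _ = _ * (X * _)]Su' -mulrA [u^-1 * _]mulrCA; congr (_ * _).
    rewrite mulr_suml mulr_sumr (reindex_inj rev_ord_inj) /=.
    apply: eq_bigr => j _; rewrite subSS.
    have jd : (j <= d)%N by rewrite -ltnS.
    rewrite subKn //; case: ifP => [lt_j|/negbT]; last first.
      rewrite -leqNgt => le_j; rewrite (nth_default _ (s := q)) ?mul0r ?mulr0 //.
      by case: (size q) le_j.
    rewrite -!mulrA; congr (_ * (_ * _)).
    by rewrite exprVn mulrC -expfB_cond ?(negPf y0) ?subSS.
  pose p' := \poly_(i < d.+1) p`_i + p`_d.+1 *: (pi *: q').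
  apply: (IH y p' q) => //.
  - move=> i; rewrite coefD !coefZ !coef_poly; apply: (SD).
      by case: ifP.
    apply: (SM) => //; apply: (SM) => //; case: ifP => // _.
    by case: ifP => // _; apply: (SM).
  - rewrite -ltnS (leq_trans _ le_n) // ltn_add2r sizeE ltnS.
    apply: leq_trans (size_polyD _ _) _; rewrite geq_max size_poly /=.
    by do 2!apply: leq_trans (size_scale_leq _ _) _; exact: size_poly.
  - rewrite -pE; congr (_ * _); rewrite hornerD !hornerZ q'E horner_poly.
    by rewrite (@horner_coef_wide _ d.+2 p) ?sizeE // [RHS]big_ord_recr.
move=> x; apply: contrapT => /not_orP[nx nVx].
have x0 : x != 0 by apply: contra_notN nx => /eqP ->.
have [p Sp pE] := adjoin x nx; have [q Sq qE] := adjoin x^-1 nVx.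
exact: (reduce _ x p q Sp Sq (leqnn _)).
Qed.

End ValuationRing.

Record valuation (L : fieldType) := Valuation {
  val_mem : pred L;
  val_subring : subring_closed val_mem;
  val_total : forall x, val_mem x || val_mem x^-1
}.

Section ResidueField.
Variables (L : fieldType) (V : valuation L).

HB.instance Definition _ := GRing.isSubringClosed.Build L (val_mem V) (val_subring V).

Definition val_ring := {x : L | val_mem V x}.

HB.instance Definition _ := SubType.on val_ring.
HB.instance Definition _ := Choice.on val_ring.
HB.instance Definition _ := [SubChoice_isSubComNzRing of val_ring by <:].

Let in_ring x (Vx : val_mem V x) : val_ring := exist (fun y => val_mem V y) x Vx.

Definition val_max : pred val_ring := [pred x | (x == 0) || ((val x)^-1 \notin val_mem V)].

Lemma val_maxP (x : val_ring) :
  reflect (forall y : val_ring, x * y != 1) (val_max x).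
Proof.
apply: (iffP idP) => [/orP[/eqP -> y|nVx y]|H].
- by rewrite mul0r eq_sym oner_eq0.
- apply: contraNneq nVx => /(congr1 val) /= xy.
  have x0 : val x != 0.
    by apply/eqP => x0; move/eqP: xy; rewrite x0 mul0r eq_sym oner_eq0.
  by rewrite -[_^-1]mulr1 -xy mulKf //; exact: (valP y).
apply/norP => -[x0 /negbNE Vx]; have := H (in_ring Vx); rewrite -val_eqE /=.
by rewrite divff ?eqxx //; apply: contraNneq x0 => x0; apply/eqP/val_inj.
Qed.

(** For sums: one of x / y and y / x is in the ring, so x + y is a multiple of y or of x. *)
Lemma val_max_ideal : idealr_closed val_max.
Proof.
split=> [||a x y xM yM]; first by apply/val_maxP => y; rewrite mul0r eq_sym oner_eq0.
  by apply/negP => /val_maxP/(_ 1); rewrite mulr1 eqxx.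
have mulM (b z : val_ring) : z \in val_max -> b * z \in val_max.
  by move=> /val_maxP zM; apply/val_maxP => c; rewrite [b * z]mulrC -mulrA.
have {xM}axM := mulM a x xM; move: (a * x) axM => {}x xM.
have addM (u w r : val_ring) : u = r * w -> w \in val_max -> u + w \in val_max.
  by move=> -> wM; rewrite -{2}[w]mul1r -mulrDl; apply: mulM.
have [y0|y0] := eqVneq (val y) 0.
  by rewrite (_ : y = 0) ?addr0 //; apply: val_inj.
have [x0|x0] := eqVneq (val x) 0.
  by rewrite (_ : x = 0) ?add0r //; apply: val_inj.
have /orP[Vr|] := val_total V (val x / val y).
  apply: (addM _ _ (in_ring Vr)) => //.
  by apply: val_inj; rewrite /= divfK.
rewrite invf_div => Vr; rewrite addrC.
apply: (addM _ _ (in_ring Vr)) => //.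
by apply: val_inj; rewrite /= divfK.
Qed.

HB.instance Definition _ := isIdealr.Build val_ring val_max val_max_ideal.

Definition val_max_idealr : idealr val_ring := val_max.

Definition residue_field := {ideal_quot val_max_idealr}.

HB.instance Definition _ := GRing.ComNzRing.on residue_field.

Definition residue (x : val_ring) : residue_field := (\pi_residue_field x)%qT.

Lemma residue_zmod_morphism : zmod_morphism residue.
Proof. by move=> x y; exact: (rmorphB (\pi_residue_field)%qT). Qed.

Lemma residue_monoid_morphism : monoid_morphism residue.
Proof.
split=> [|x y]; first exact: (rmorph1 (\pi_residue_field)%qT).
exact: (rmorphM (\pi_residue_field)%qT).
Qed.

HB.instance Definition _ := GRing.isZmodMorphism.Build val_ring residue_field
  residue residue_zmod_morphism.
HB.instance Definition _ := GRing.isMonoidMorphism.Build val_ring residue_field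
  residue residue_monoid_morphism.

Lemma residue_eq0 x : (residue x == 0) = val_max x.
Proof. by rewrite -(rmorph0 residue) -Quotient.idealrBE subr0. Qed.

Definition residue_inv (q : residue_field) : residue_field :=
  if q == 0 then 0 else residue (insubd (0 : val_ring) (val (repr q))^-1).

Lemma residue_mulVf (q : residue_field) : q != 0 -> residue_inv q * q = 1.
Proof.
move=> q0; rewrite /residue_inv (negPf q0) -{2}[q]reprK.
move: q0; rewrite -{1}[q]reprK; move: (repr q) => x.
rewrite -[(\pi x)%qT]/(residue x) residue_eq0 => /norP[x0 /negbNE Vx].
rewrite -rmorphM -(rmorph1 residue); congr residue; apply: val_inj => /=.
by rewrite insubdK // mulVf.
Qed.

Lemma residue_inv0 : residue_inv 0 = 0.
Proof. by rewrite /residue_inv eqxx. Qed.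

HB.instance Definition _ := GRing.ComNzRing_isField.Build residue_field
  residue_mulVf residue_inv0.

End ResidueField.

(** A place centred at p, presented only by the inclusion of its ring R and the reduction to K, so
    that formulas are transported by ring morphisms. *)
Lemma exists_place (A : comNzRingType) (L : fieldType) (phi : {rmorphism A -> L}) (p : A) :
  (forall a, phi a * phi p != 1) ->
  exists (R : comNzRingType) (K : fieldType) (incl : {rmorphism R -> L})
    (res : {rmorphism R -> K}),
  [/\ injective incl, forall x, (exists r, incl r = x) \/ (exists r, incl r = x^-1),
      forall a, exists r, incl r = phi a & forall r, incl r = phi p -> res r = 0].
Proof.
move=> p_nonunit.
have [|||V [[V1 VB VM] AV Vtot Vp]] := @valuation_ring_exists L (range phi) (phi p).
- split; first by exists 1; rewrite // rmorph1.
    by move=> _ _ [a _ <-] [b _ <-]; exists (a - b); rewrite // rmorphB.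
  by move=> _ _ [a _ <-] [b _ <-]; exists (a * b); rewrite // rmorphM.
- by exists p.
- by move=> _ [a _ <-].
pose Vb : pred L := fun x => `[< V x >].
have Vring : subring_closed Vb.
  by split=> [|x y /asboolP ? /asboolP ?|x y /asboolP ? /asboolP ?]; apply/asboolP; auto.
have Vbtot x : Vb x || Vb x^-1 by apply/orP; case: (Vtot x) => ?; [left|right]; apply/asboolP.
pose W := Valuation Vring Vbtot.
have lift (x : L) : V x -> exists r : val_ring W, val r = x.
  by move=> Vx; exists (exist (fun y => val_mem W y) x (asboolT Vx)).
exists (val_ring W), (residue_field W), (val : {rmorphism val_ring W -> L}), (@residue _ W).
split; first exact: val_inj.
- by move=> x; case: (Vtot x) => /lift; [left | right].
- by move=> a; apply/lift/AV; exists a.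
move=> r rp; apply/eqP; rewrite residue_eq0; apply/val_maxP => y.
apply/eqP => /(congr1 val) /=; rewrite mulrC => ry.
have := Vp (val y); rewrite -rp => /(_ (asboolW (valP y))) /eqP; apply.
by rewrite -ry.
Qed.

(** * Smoothness *)

Section CubicSum.
Variable K : fieldType.
Hypothesis natK : forall n, n.+1%:R != 0 :> K.

Lemma intr_eq0_char0 (z : int) : z%:~R = 0 :> K -> z = 0.
Proof.
case: z => [[//|n]|n] => z0; first by have /eqP[] := natK n.
by have /eqP[] := natK n; apply: oppr_inj; rewrite oppr0.
Qed.

(** An arithmetic obstruction: cubing 256 p = C - 9 r and inserting the possible cubes forces a
    nonzero integer to vanish in K, which has characteristic zero. *)
Lemma cube_roots_relation (p r C : K) (c : int) :
  C = c%:~R -> c = 96 \/ c = 48 -> 256 * p = C - 9 * r ->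
  p = 0 \/ p ^+ 3 = - 25 -> r = 0 \/ r ^+ 3 = 1 \/ r ^+ 3 = - 8 -> False.
Proof.
move=> CE c_val pE p_val r_val.
have cube : (C - 9 * r) ^+ 3 = 0 \/ (C - 9 * r) ^+ 3 = - 25 * 2 ^+ 24.
  rewrite -pE; case: p_val => [->|p3]; first by left; ring.
  by right; transitivity (2 ^+ 24 * p ^+ 3); [ring | rewrite p3; ring].
have zero (e : int) : e%:~R = 0 :> K -> e <> 0 -> False by move=> /intr_eq0_char0.
case: cube => cube.
  have /eqP := cube; rewrite expf_eq0 /= subr_eq0 => /eqP CrE.
  case: r_val => [r0|r3].
    apply: (zero c); last by case: c_val => ->.
    by rewrite -CE CrE r0; ring.
  have C3 : C ^+ 3 = 729 * r ^+ 3 by rewrite CrE; ring.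
  case: r3 => r3.
    apply: (zero (c ^+ 3 - 729)); last by case: c_val => ->; lia.
    by transitivity (C ^+ 3 - 729); [rewrite CE; ring | rewrite C3 r3; ring].
  apply: (zero (c ^+ 3 + 5832)); last by case: c_val => ->; lia.
  by transitivity (C ^+ 3 + 5832); [rewrite CE; ring | rewrite C3 r3; ring].
case: r_val => [r0|[r3|r3]].
- apply: (zero (c ^+ 3 + 25 * 2 ^+ 24)); last by case: c_val => ->; lia.
  transitivity ((C - 9 * r) ^+ 3 + 25 * 2 ^+ 24); first by rewrite CE r0; ring.
  by rewrite cube; ring.
- have : (r - 1) * (r ^+ 2 + r + 1) = 0.
    by transitivity (r ^+ 3 - 1); [ring | rewrite r3; ring].
  move/eqP; rewrite mulf_eq0 subr_eq0 => /orP[/eqP r1|/eqP r2].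
    apply: (zero ((c - 9) ^+ 3 + 25 * 2 ^+ 24)); last by case: c_val => ->; lia.
    transitivity ((C - 9 * r) ^+ 3 + 25 * 2 ^+ 24); first by rewrite CE r1; ring.
    by rewrite cube; ring.
  (* Modulo r^2 + r + 1 the cubed relation becomes a + b r = 0; its norm a^2 - a b + b^2 is a
     nonzero integer. The factor r^2 - 2 r + 4 is treated likewise below. *)
  pose a : int := c ^+ 3 - 729 - 243 * c + 25 * 2 ^+ 24.
  pose b : int := - 27 * c * (c + 9).
  have ab : b%:~R * r = - a%:~R.
    apply/eqP; rewrite -subr_eq0 opprK; apply/eqP.
    transitivity ((C - 9 * r) ^+ 3 + 25 * 2 ^+ 24
      + 729 * (r - 1) * (r ^+ 2 + r + 1) - 243 * C * (r ^+ 2 + r + 1)).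
      by rewrite /a /b CE; ring.
    by rewrite cube r2; ring.
  apply: (zero (a ^+ 2 - a * b + b ^+ 2)); last by rewrite /a /b; case: c_val => ->; lia.
  transitivity (b%:~R ^+ 2 * (r ^+ 2 + r + 1)); last by rewrite r2 mulr0.
  transitivity ((b%:~R * r) ^+ 2 + (b%:~R * r) * b%:~R + b%:~R ^+ 2); last ring.
  by rewrite ab; ring.
have : (r + 2) * (r ^+ 2 - 2 * r + 4) = 0.
  by transitivity (r ^+ 3 + 8); [ring | rewrite r3; ring].
move/eqP; rewrite mulf_eq0 addr_eq0 => /orP[/eqP r1|/eqP r2].
  apply: (zero ((c + 18) ^+ 3 + 25 * 2 ^+ 24)); last by case: c_val => ->; lia.
  transitivity ((C - 9 * r) ^+ 3 + 25 * 2 ^+ 24); first by rewrite CE r1; ring.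
  by rewrite cube; ring.
pose a : int := c ^+ 3 + 5832 - 972 * c + 25 * 2 ^+ 24.
pose b : int := - 27 * c * (c - 18).
have ab : b%:~R * r = - a%:~R.
  apply/eqP; rewrite -subr_eq0 opprK; apply/eqP.
  transitivity ((C - 9 * r) ^+ 3 + 25 * 2 ^+ 24
    + 729 * (r + 2) * (r ^+ 2 - 2 * r + 4) - 243 * C * (r ^+ 2 - 2 * r + 4)).
    by rewrite /a /b CE; ring.
  by rewrite cube r2; ring.
apply: (zero (a ^+ 2 + 2 * a * b + 4 * b ^+ 2)); last first.
  by rewrite /a /b; case: c_val => ->; lia.
transitivity (b%:~R ^+ 2 * (r ^+ 2 - 2 * r + 4)); last by rewrite r2 mulr0.
transitivity ((b%:~R * r) ^+ 2 - 2 * (b%:~R * r) * b%:~R + 4 * b%:~R ^+ 2); last ring.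
by rewrite ab; ring.
Qed.

End CubicSum.

Section Gradient.
Variables (A : comNzRingType) (t : A).

Lemma gradient_scale c x i : gradient t (fun j => c * x j) i = c ^+ 3 * gradient t x i.
Proof.
rewrite /gradient /quad0 /quad1 /quad2.
by do 7?[case: i => [|i] /=]; rewrite ?nth_nil; ring.
Qed.

(** Stated for any derivation killing t, so that the partial derivatives of the form follow without
    expanding monomials. *)
Lemma derivation_quartic m (D : {additive A -> A}) x :
  (forall a b, D (a * b) = D a * b + a * D b) -> D t = 0 ->
  D (quartic m t x) = \sum_(i < 7 + m) gradient t x i * D (x i).
Proof.
move=> DM Dt.
have D1 : D 1 = 0.
  by apply: (addrI (D 1)); rewrite addr0 -{3}[1](mulr1 1) DM mulr1 mul1r.
have Dn n : D n%:R = 0 by rewrite raddfMn /= D1 mul0rn.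
have DX a n : D (a ^+ n.+1) = n.+1%:R * a ^+ n * D a.
  elim: n => [|n IH]; first by rewrite expr1 expr0 !mul1r.
  by rewrite exprS DM IH -[n.+2%:R]natr1 exprS; ring.
rewrite big_split_ord /= !big_ord_recl big_ord0 /=.
have -> : \sum_(i < m) gradient t x (7 + i) * D (x (7 + i)%N) = D (tail4 m x).
  by rewrite raddf_sum; apply: eq_bigr => i _; rewrite DX /gradient nth_default ?leq_addr.
rewrite /quartic /residual /gradient /quad0 /quad1 /quad2 /=.
rewrite !(raddfD, raddfB, raddfN, DM, DX, Dn, Dt, D1) /=.
ring.
Qed.

End Gradient.

Lemma mderiv_quartic_form (R : comNzRingType) m (t : R) i :
  (quartic_form m t)^`M(i) = gradient t%:MP (fun j => 'X_(inord j)) i.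
Proof.
have := @derivation_quartic _ t%:MP m (mderiv i) (fun j => 'X_(inord j)).
rewrite /= mderivC => -> //; last by move=> a b; rewrite mderivM.
rewrite (bigD1 (i : 'I_(7 + m))) //= big1 ?addr0 => [|j ji].
  rewrite inord_val mderivX mnm1E eqxx scale1r.
  have -> : (U_(i) - U_(i))%MM = 0%MM by apply/mnmP => k; rewrite mnmBE subnn mnm0E.
  by rewrite mpolyX0 mulr1.
rewrite mderivX mnm1E (_ : inord j == i = false) ?scale0r ?mulr0 //.
by apply: contraNF ji => /eqP <-; apply/eqP/val_inj; rewrite /= inordK //; exact: (ltn_ord j).
Qed.

Lemma vanishes_at_gradient (F L : fieldType) (iota : {rmorphism F -> L}) m (t : F) i
    (x : 'rV[L]_m.+4.+3) :
  vanishes_at iota (quartic_form m t)^`M(i) x ->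
  gradient (iota t) (fun j => x 0 (inord j)) i = 0.
Proof.
rewrite /vanishes_at mderiv_quartic_form.
rewrite [map_mpoly _ _](gradient_morph (map_mpoly iota)) /= map_mpolyC.
rewrite (_ : _ \o _ = fun j => 'X_(inord j)); last first.
  by apply/funext => j /=; rewrite map_mpolyX.
rewrite [_.@[_]](gradient_morph (meval (x 0))) /= mevalC => <-.
by congr (gradient _ _ _); apply/funext => j /=; rewrite mevalXU.
Qed.

(** Smoothness of the fibre at t = 1. If k = [quad0 1 y] is zero, the coordinates vanish one after
    another; otherwise the ratios of x1^2 and x2^2 to k have known cubes, incompatible with the
    definition of k. *)
Lemma gradient1_eq0 (K : fieldType) m (y : nat -> K) :
  (forall n, n.+1%:R != 0 :> K) ->
  (forall i, (i < 7 + m)%N -> gradient 1 y i = 0) -> forall i, (i < 7 + m)%N -> y i = 0.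
Proof.
move=> natK grad0.
have cancel (n : nat) (c : K) : n.+1%:R * c = 0 -> c = 0.
  by move/eqP; rewrite mulf_eq0 (negPf (natK n)) => /eqP.
have cube0 (c : K) : c ^+ 3 = 0 -> c = 0 by move/eqP; rewrite expf_eq0 => /eqP.
have sq0 (c : K) : c ^+ 2 = 0 -> c = 0 by move/eqP; rewrite expf_eq0 => /eqP.
set k := quad0 1 y.
have ga : y 0%N * (k + 2 * y 0%N ^+ 2) = 0.
  apply: (cancel 3%N); have /= := grad0 0%N isT; rewrite /gradient /= -/k => H.
  by apply: oppr_inj; rewrite oppr0 -[RHS]H; ring.
have g1 : y 1%N * (4 * k + 3 * y 4%N * y 1%N) = 0.
  by rewrite -[RHS](grad0 1%N isT) /gradient /= -/k; ring.
have g2 : y 2%N * (k + 8 * (y 6%N - y 5%N) * y 2%N) = 0.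
  by apply: (cancel 11%N); rewrite -[RHS](grad0 2%N isT) /gradient /= -/k; ring.
have g3 : y 3%N * k = 0.
  by apply: (cancel 3%N); rewrite -[RHS](grad0 3%N isT) /gradient /= -/k; ring.
have g4 : y 1%N ^+ 3 = 200 * y 4%N ^+ 3.
  by apply: subr0_eq; rewrite -[RHS](grad0 4%N isT) /gradient /=; ring.
have g5 : y 5%N ^+ 3 = 8 * y 2%N ^+ 3.
  apply: subr0_eq; apply: (cancel 3%N).
  by rewrite -[RHS](grad0 5%N isT) /gradient /=; ring.
have g6 : y 6%N ^+ 3 = - (8 * y 2%N ^+ 3).
  apply: subr0_eq; apply: (cancel 3%N).
  by rewrite -[RHS](grad0 6%N isT) /gradient /=; ring.
have kE : k = y 1%N ^+ 2 + 3 * y 2%N ^+ 2 + y 3%N ^+ 2 - y 0%N ^+ 2.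
  by rewrite /k /quad0; ring.
have tail i : (7 <= i < 7 + m)%N -> y i = 0.
  case/andP=> i7 im; apply/cube0/(cancel 3%N).
  by rewrite -[RHS](grad0 i im) /gradient nth_default.
have [k0|k0] := eqVneq k 0.
  have a0 : y 0%N = 0.
    by apply/cube0/(cancel 1%N); rewrite -[RHS]ga k0; ring.
  have [x10 b0] : y 1%N = 0 /\ y 4%N = 0.
    have /eqP : y 4%N * y 1%N ^+ 2 = 0.
      by apply: (cancel 2%N); rewrite -[RHS]g1 k0; ring.
    rewrite mulf_eq0 sqrf_eq0 => /orP[] /eqP z; rewrite z in g4 *; split=> //; apply: cube0.
      by rewrite g4; ring.
    by apply: (cancel 199%N); rewrite -g4; ring.
  have x20 : y 2%N = 0.
    have /eqP : (y 6%N - y 5%N) * y 2%N ^+ 2 = 0.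
      by apply: (cancel 7%N); rewrite -[RHS]g2 k0; ring.
    rewrite mulf_eq0 sqrf_eq0 subr_eq0 => /orP[/eqP eg|/eqP //].
    apply/cube0/(cancel 15%N); rewrite -[RHS](subrr (y 5%N ^+ 3)) -{2}eg g5 g6; ring.
  have e0 : y 5%N = 0 by apply: cube0; rewrite g5 x20; ring.
  have g0 : y 6%N = 0 by apply: cube0; rewrite g6 x20; ring.
  have x30 : y 3%N = 0 by apply: sq0; rewrite -k0 kE a0 x10 x20; ring.
  move=> i im; have [i7|i7] := ltnP i 7; last by apply: tail; rewrite i7.
  by case: i i7 {im} => [|[|[|[|[|[|[|//]]]]]]].
exfalso.
have x30 : y 3%N = 0 by move/eqP: g3; rewrite mulf_eq0 (negPf k0) orbF => /eqP.
(* The weights make p^3 and r^3 integers; with x3 = 0 the definition of k becomes 256 p + 9 r = 96 +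
   96 a^2 / k, that is 96 when a = 0 and 48 when k = - 2 a^2. *)
pose p := 3 * y 1%N ^+ 2 / (8 * k); pose r := 32 * y 2%N ^+ 2 / k.
have k8 : 8 * k != 0 by rewrite mulf_neq0 // (natK 7%N).
have pk : 8 * k * p = 3 * y 1%N ^+ 2 by rewrite /p mulrC divfK.
have rk : k * r = 32 * y 2%N ^+ 2 by rewrite /r mulrC divfK.
have p_val : p = 0 \/ p ^+ 3 = - 25.
  move/eqP: g1; rewrite mulf_eq0 => /orP[/eqP x10|/eqP b1].
    by left; rewrite /p x10 expr0n mulr0 mul0r.
  right; apply: (mulfI (expf_neq0 3 k8)); rewrite -exprMn pk.
  have b1' : 3 * y 4%N * y 1%N = - (4 * k) by apply: subr0_eq; rewrite -[RHS]b1; ring.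
  transitivity (200 * (3 * y 4%N * y 1%N) ^+ 3); last by rewrite b1'; ring.
  by transitivity (27 * y 1%N ^+ 3 * y 1%N ^+ 3); [ring | rewrite {1}g4; ring].
have r_val : r = 0 \/ r ^+ 3 = 1 \/ r ^+ 3 = - 8.
  move/eqP: g2; rewrite mulf_eq0 => /orP[/eqP x20|/eqP b2].
    by left; rewrite /r x20 expr0n mulr0 mul0r.
  right; set u := y 6%N - y 5%N in b2; set s := y 2%N in g5 g6 b2 rk kE.
  have us : 8 * u * s = - k by apply: subr0_eq; rewrite -[RHS]b2; ring.
  (* From g^3 - e^3 = u^3 + 3 e g u. Cubing then eliminates the product e g, because (e g)^3 = - 64
     s^6. *)
  have uE : u ^+ 3 + 16 * s ^+ 3 = - (3 * (y 5%N * y 6%N) * u).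
    transitivity (y 6%N ^+ 3 - y 5%N ^+ 3 - 3 * (y 5%N * y 6%N) * u + 16 * s ^+ 3).
      by rewrite /u; ring.
    by rewrite g5 g6; ring.
  have uE3 : (u ^+ 3 + 16 * s ^+ 3) ^+ 3 = 1728 * s ^+ 6 * u ^+ 3.
    transitivity (- (27 * (y 5%N ^+ 3 * y 6%N ^+ 3) * u ^+ 3)); first by rewrite uE; ring.
    by rewrite g5 g6; ring.
  have : (r ^+ 3 - 1) * (r ^+ 3 + 8) ^+ 2 = 0.
    apply: (mulfI (expf_neq0 9 k0)); rewrite mulr0.
    transitivity (((k * r) ^+ 3 - k ^+ 3) * ((k * r) ^+ 3 + 8 * k ^+ 3) ^+ 2); first ring.
    rewrite rk (_ : k = - (8 * u * s)); last by rewrite us opprK.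
    transitivity (2 ^+ 33 * s ^+ 9 * ((u ^+ 3 + 16 * s ^+ 3) ^+ 3
      - 1728 * s ^+ 6 * u ^+ 3)); first ring.
    by rewrite uE3 subrr mulr0.
  move/eqP; rewrite mulf_eq0 sqrf_eq0 subr_eq0 addr_eq0.
  by case/orP => /eqP; [left | right].
have sumE : 8 * k * (256 * p + 9 * r - 96) = 96 * 8 * y 0%N ^+ 2.
  transitivity (256 * (8 * k * p) + 72 * (k * r) - 768 * k); first ring.
  by rewrite pk rk kE x30; ring.
move/eqP: ga; rewrite mulf_eq0 => /orP[/eqP a0|/eqP a2].
  apply: (@cube_roots_relation _ natK p r 96 96); rewrite ?rmorph_nat //; auto.
  apply: subr0_eq; apply: (mulfI k8); rewrite mulr0 -[RHS](mulr0 (96 * 8)).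
  by rewrite (_ : 0 = y 0%N ^+ 2) -?sumE ?a0 ?expr0n //; ring.
apply: (@cube_roots_relation _ natK p r 48 48); rewrite ?rmorph_nat //; auto.
apply: subr0_eq; apply: (mulfI k8); rewrite mulr0.
transitivity (8 * k * (256 * p + 9 * r - 96) + 48 * 8 * k); first ring.
by rewrite sumE; transitivity (48 * 8 * (k + 2 * y 0%N ^+ 2)); [ring | rewrite a2 mulr0].
Qed.

(** Selects an entry of least valuation by comparing ratios, so that a projective point gets
    integral coordinates, one of them equal to 1. *)
Lemma place_normalize (L : fieldType) (V : L -> Prop) (s : seq L) :
  V 0 -> V 1 -> (forall x y, V x -> V y -> V (x * y)) ->
  (forall x, V x \/ V x^-1) -> has (predC1 0) s ->
  exists2 y, y \in s & y != 0 /\ {in s, forall z, V (z / y)}.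
Proof.
move=> V0 V1 VM Vtot; elim: s => //= z s IH.
have [/IH[y ys [y0 yV]] _|s0] := boolP (has (predC1 0) s).
  have [Vzy|] := Vtot (z / y).
    exists y; first by rewrite inE ys orbT.
    by split=> // w; rewrite inE => /orP[/eqP ->|/yV].
  rewrite invf_div => Vyz; have [z0|z0] := eqVneq z 0.
    exists y; first by rewrite inE ys orbT.
    by split=> // w; rewrite inE => /orP[/eqP ->|/yV //]; rewrite z0 mul0r.
  exists z; first by rewrite inE eqxx.
  split=> // w; rewrite inE => /orP[/eqP ->|ws]; first by rewrite divff.
  have -> : w / z = w / y * (y / z) by rewrite mulrA divfK.
  by apply: VM => //; apply: yV.
rewrite orbF => z0; exists z; first by rewrite inE eqxx.
split=> // w; rewrite inE => /orP[/eqP ->|ws]; first by rewrite divff.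
have -> : w = 0 by move/hasPn: s0 => /(_ w ws) /negbNE /eqP.
by rewrite mul0r.
Qed.

Lemma smooth_quartic_form m : smooth_hypersurface (quartic_form m frac_t).
Proof.
move=> L iota x x0 _; apply: contrapT => /forallNP sing.
have {}sing i : (i < 7 + m)%N -> gradient (iota frac_t) (fun j => x 0 (inord j)) i = 0.
  by move=> lt_i; have /contrapT/vanishes_at_gradient := sing (Ordinal lt_i).
pose phi : {rmorphism {poly rat} -> L} := iota \o @tofrac _.
(* The place exists because t - 1 is not invertible in Q[t]; its residue field has characteristic
   zero because its ring contains Q. *)
have [a|R [K [incl [res [incl_inj Vtot Aincl res0]]]]] := @exists_place _ _ phi ('X - 1).
  rewrite -rmorphM -(rmorph1 phi) (inj_eq (inj_comp (fmorph_inj iota) (@tofrac_inj _))).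
  apply/eqP => /(congr1 (fun p : {poly rat} => p.[1])); rewrite hornerM hornerD.
  by rewrite hornerX hornerN hornerC subrr mulr0 => /esym/eqP; rewrite oner_eq0.
have natK n : n.+1%:R != 0 :> K.
  have [r rE] := Aincl ((n.+1%:R)^-1)%:P.
  have : r * n.+1%:R = 1.
    apply: incl_inj; rewrite rmorphM rE rmorph_nat rmorph1 -(rmorph_nat phi) -rmorphM.
    by rewrite -(rmorph_nat polyC) -polyCM mulVf ?rmorph1 // pnatr_eq0.
  move/(congr1 res); rewrite rmorphM rmorph_nat rmorph1 => rn; apply/eqP => n0.
  by move/eqP: rn; rewrite n0 mulr0 eq_sym oner_eq0.
have [T TE] := Aincl 'X.
have resT : res T = 1.
  apply/subr0_eq; rewrite -(rmorph1 res) -rmorphB; apply: res0.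
  by rewrite rmorphB rmorph1 TE -(rmorph1 phi) -rmorphB.
pose V y := exists r, incl r = y.
have [|||||y] := @place_normalize L V [seq x 0 i | i <- enum 'I_m.+4.+3].
- by exists 0; rewrite rmorph0.
- by exists 1; rewrite rmorph1.
- by move=> _ _ [r <-] [r' <-]; exists (r * r'); rewrite rmorphM.
- exact: Vtot.
- apply: contraNT x0 => /hasPn x0; apply/eqP/rowP => i; rewrite mxE.
  by apply/eqP/negbNE/x0/map_f; rewrite mem_enum.
case/mapP => j _ -> [xj0 xV].
have /choice[X XE] : forall i, exists r, incl r = (x 0 j)^-1 * x 0 (@inord m.+4.+2 i).
  by move=> i; rewrite mulrC; apply: xV; apply: map_f; rewrite mem_enum.
have grad0 i : (i < 7 + m)%N -> gradient 1 (res \o X) i = 0.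
  move=> lt_i; rewrite -resT -gradient_morph (_ : gradient T X i = 0) ?rmorph0 //.
  apply: incl_inj; rewrite rmorph0 gradient_morph TE.
  have -> : incl \o X = fun i => (x 0 j)^-1 * x 0 (inord i) by apply/funext => k /=.
  by rewrite gradient_scale sing // mulr0.
have := gradient1_eq0 natK grad0 (ltn_ord j) => /= Xj0.
have Xj1 : X j = 1 by apply: incl_inj; rewrite XE inord_val mulVf // rmorph1.
by move/eqP: Xj0; rewrite Xj1 rmorph1 oner_eq0.
Qed.

(** * Algebraic independence *)

Section MpolyDerivation.
Variables (n : nat) (R : comNzRingType).
Implicit Types (p q : {mpoly R[n]}).

Lemma mpoly_alg_ind (Q : {mpoly R[n]} -> Prop) :
  (forall c, Q c%:MP) -> (forall p q, Q p -> Q q -> Q (p + q)) ->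
  (forall i p, Q p -> Q ('X_i * p)) -> forall p, Q p.
Proof.
move=> QC QD QX; elim/mpolyind => [|c m p _ _ Qp]; first by rewrite -mpolyC0.
apply: QD => //; have [k] := ubnP (mdeg m); elim: k m => // k IH m lt_mk.
have [m0|/eqP m0] := eqVneq (mdeg m) 0%N.
  by move/eqP: m0; rewrite mdeg_eq0 => /eqP ->; rewrite mpolyX0 -mul_mpolyC mulr1.
have [i mi] : exists i, (0 < m i)%N.
  apply/existsP; apply: contra_notT m0; rewrite negb_exists => /forallP m0.
  by rewrite mdegE big1 // => i _; apply/eqP; rewrite -leqn0 leqNgt.
have mE : m = (U_(i) + (m - U_(i)))%MM by rewrite addmC submK // lep1mP -lt0n.
rewrite mE mpolyXD -mul_mpolyC mulrCA mul_mpolyC; apply: QX; apply: IH.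
by move: lt_mk; rewrite {1}mE mdegD mdeg1.
Qed.

Lemma mmap_derivation (S : comNzRingType) (f : {rmorphism R -> S}) (h : 'I_n -> S)
    (D : {additive S -> S}) p :
  (forall a b, D (a * b) = D a * b + a * D b) -> (forall c, D (f c) = 0) ->
  D (mmap f h p) = \sum_i mmap f h p^`M(i) * D (h i).
Proof.
move=> DM Df; elim/mpoly_alg_ind: p => [c|p q Dp Dq|j p Dp].
- by rewrite mmapC Df big1 // => i _; rewrite mderivC mmap0 mul0r.
- rewrite mmapD raddfD Dp Dq -big_split; apply: eq_bigr => i _.
  by rewrite mderivD mmapD mulrDl.
rewrite rmorphM /= DM Dp mmapX mmap1U.
have -> : D (h j) = \sum_i (i == j)%:R * D (h i).
  by rewrite (bigD1 j) //= eqxx mul1r big1 ?addr0 // => i /negPf ->; rewrite mul0r.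
rewrite mulr_suml mulr_sumr -big_split; apply: eq_bigr => i _ /=.
rewrite mderivM mmapD !rmorphM /= mmapX mmap1U mderivX mnm1E [j == i]eq_sym.
case: (i =P j) => [->|_]; last by rewrite scale0r mmap0 !mul0r !add0r mulrA.
have -> : (U_(j) - U_(j))%MM = 0%MM by apply/mnmP => k; rewrite mnmBE subnn mnm0E.
by rewrite mpolyX0 scale1r rmorph1; ring.
Qed.

Hypothesis natR : forall (k : nat) (c : R), k.+1%:R * c = 0 -> c = 0.

(** Descent on the degree: the derivatives of a member vanish by induction, so it is constant by
    [natR], hence zero. *)
Lemma mderiv_stable_eq0 (Q : {mpoly R[n]} -> Prop) :
  (forall p i, Q p -> Q p^`M(i)) -> (forall c, Q c%:MP -> c = 0) ->
  forall p, Q p -> p = 0.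
Proof.
move=> QD QC; suff bound k p : (forall m, (k <= mdeg m)%N -> p@_m = 0) -> Q p -> p = 0.
  move=> p; apply: (bound (msize p)) => m le_m; apply: memN_msupp_eq0.
  by apply/negP => /msize_mdeg_lt; rewrite ltnNge le_m.
elim: k p => [|k IH] p pk Qp; first by apply/mpolyP => m; rewrite pk ?mcoeff0.
have dp i : p^`M(i) = 0.
  apply: IH; last exact: QD.
  by move=> m le_m; rewrite mcoeff_deriv pk ?mul0rn // mdegD mdeg1 addn1.
have pE : p = (p@_0%MM)%:MP.
  apply/mpolyP => m; rewrite mcoeffC; have [->|m0] := eqVneq 0%MM m; first by rewrite mulr1.
  rewrite mulr0; have [i mi] : exists i, (0 < m i)%N.
    apply/existsP; apply: contraNT m0; rewrite negb_exists => /forallP m0.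
    by apply/eqP/mnmP => i; rewrite mnm0E; apply/esym/eqP; rewrite -leqn0 leqNgt.
  have := congr1 (mcoeff (m - U_(i))) (dp i).
  rewrite mcoeff_deriv mcoeff0 submK ?lep1mP -?lt0n // mnmBE mnm1E eqxx -mulr_natl.
  exact: natR.
by rewrite pE (QC p@_0) // -pE.
Qed.

End MpolyDerivation.

Section Lines.
Variables (n : nat) (F : idomainType).
Hypothesis natF : forall k, k.+1%:R != 0 :> F.

Definition axis_line i (v : 'I_n -> F) : {mpoly F[n]} -> {poly F} :=
  mmap polyC (fun j => (v j)%:P + (j == i)%:R * 'X).

HB.instance Definition _ i v := GRing.RMorphism.on (axis_line i v).

Lemma axis_line_horner i v p s : (axis_line i v p).[s] = p.@[fun j => v j + (j == i)%:R * s].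
Proof.
elim/mpoly_alg_ind: p => [c|p q Dp Dq|j p Dp].
- by rewrite /axis_line mmapC mevalC hornerC.
- by rewrite rmorphD hornerD Dp Dq mevalD.
rewrite rmorphM hornerM Dp mevalM mevalXU /= /axis_line mmapX mmap1U.
by rewrite hornerD hornerC hornerM hornerX -(rmorph_nat polyC) hornerC.
Qed.

Lemma axis_line_through i v p :
  (axis_line i (fun j => if j == i then 0 else v j) p).[v i] = p.@[v].
Proof.
rewrite axis_line_horner; apply: meval_eq => j.
by case: eqP => [->|_]; rewrite ?mul1r ?add0r // mul0r addr0.
Qed.

Lemma natr_inj_char0 : injective (fun k : nat => k%:R : F).
Proof.
move=> a b; wlog le_ab : a b / (a <= b)%N.
  by move=> wl; case: (leqP a b) => [|/ltnW] le_ab E; [exact: wl | apply/esym/wl].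
move=> /= E; apply/eqP; rewrite eqn_leq le_ab /= leqNgt; apply/negP => lt_ab.
have /eqP[] := natF (b - a).-1; rewrite prednK ?subn_gt0 // natrB //.
by rewrite E subrr.
Qed.

(** Vanishing at all points passes to partial derivatives, since the restriction to each line
    parallel to an axis is zero; then [mderiv_stable_eq0] applies. *)
Lemma meval_eq0 (p : {mpoly F[n]}) : (forall v, p.@[v] = 0) -> p = 0.
Proof.
apply: (@mderiv_stable_eq0 _ _ _ (fun p => forall v, p.@[v] = 0)) => [k c|{}p i p0 v|c /(_ (fun=> 0))]; last by rewrite mevalC.
  by move/eqP; rewrite mulf_eq0 (negPf (natF k)) => /eqP.
have line0 : axis_line i v p = 0.
  by apply: (poly_eq0_horner natr_inj_char0) => s; rewrite axis_line_horner.
have := @mmap_derivation n F _ polyC (fun j => (v j)%:P + (j == i)%:R * 'X) (@deriv F) p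
  (@derivM F) (@derivC F).
rewrite /= -/(axis_line i v p) line0 deriv0 (bigD1 i) //= big1 ?addr0 => [|j /negPf ->]; last first.
  by rewrite mul0r addr0 derivC mulr0.
rewrite eqxx mul1r derivD derivC add0r derivX mulr1 => /(congr1 (horner^~ 0)).
rewrite horner0 -/(axis_line i v _) axis_line_horner => H; rewrite [RHS]H.
by apply: meval_eq => j; rewrite mulr0 addr0.
Qed.

End Lines.

(** * Dual numbers and the Jacobian at the base point *)

Section DualNumbers.
Variable R : comNzRingType.

(** The ring R[eps] with eps^2 = 0. Evaluating at [mk_dual a a'] yields the value at a together with
    the derivative along a', without expanding the forms. *)
Definition dual : Type := (R * R)%type.

HB.instance Definition _ := GRing.Zmodule.on dual.

Definition mk_dual (a a' : R) : dual := (a, a').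

Definition dual_one : dual := (1, 0).
Definition dual_mul (x y : dual) : dual := (x.1 * y.1, x.1 * y.2 + x.2 * y.1).

Lemma dual_mulA : associative dual_mul.
Proof. by move=> [a a'] [b b'] [c c']; rewrite /dual_mul /=; congr pair; ring. Qed.
Lemma dual_mulC : commutative dual_mul.
Proof. by move=> [a a'] [b b']; rewrite /dual_mul /=; congr pair; ring. Qed.
Lemma dual_mul1 : left_id dual_one dual_mul.
Proof. by move=> [a a']; rewrite /dual_mul /=; congr pair; ring. Qed.
Lemma dual_mulD : left_distributive dual_mul +%R.
Proof. by move=> [a a'] [b b'] [c c']; congr pair; rewrite /=; ring. Qed.
Lemma dual_one_neq0 : dual_one != 0.
Proof. by apply/eqP => -[/eqP]; rewrite oner_eq0. Qed.

HB.instance Definition _ := GRing.Zmodule_isComNzRing.Build dual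
  dual_mulA dual_mulC dual_mul1 dual_mulD dual_one_neq0.

Lemma dualD a a' b b' : mk_dual a a' + mk_dual b b' = mk_dual (a + b) (a' + b').
Proof. by []. Qed.
Lemma dualN a a' : - mk_dual a a' = mk_dual (- a) (- a').
Proof. by []. Qed.
Lemma dualM a a' b b' :
  mk_dual a a' * mk_dual b b' = mk_dual (a * b) (a * b' + a' * b).
Proof. by []. Qed.
Lemma dual_nat k : k%:R = mk_dual k%:R 0.
Proof. by elim: k => // k IH; rewrite -natr1 IH -[k.+1%:R in RHS]natr1 (dualD _ _ 1 0) add0r. Qed.
Lemma dualX a a' k : mk_dual a a' ^+ k = mk_dual (a ^+ k) (k%:R * a ^+ k.-1 * a').
Proof.
elim: k => [|[|k] IH]; first by rewrite !expr0 !mul0r.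
  by rewrite !expr1 expr0 !mul1r.
rewrite exprS IH dualM -[k.+2%:R]natr1 /= -exprS [a ^+ k.+1]exprS.
by congr mk_dual; ring.
Qed.

Section DualEval.
Variables (x y : dual) (a a' b b' : R).
Hypotheses (xE : x = mk_dual a a') (yE : y = mk_dual b b').
Lemma dual_evalD : x + y = mk_dual (a + b) (a' + b').
Proof. by rewrite xE yE. Qed.
Lemma dual_evalM : x * y = mk_dual (a * b) (a * b' + a' * b).
Proof. by rewrite xE yE. Qed.
Lemma dual_evalN : - x = mk_dual (- a) (- a').
Proof. by rewrite xE. Qed.
Lemma dual_evalX k : x ^+ k = mk_dual (a ^+ k) (k%:R * a ^+ k.-1 * a').
Proof. by rewrite xE dualX. Qed.
Lemma dual_eval0 : a = 0 -> a' = 0 -> x = 0.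
Proof. by rewrite xE => -> ->. Qed.
End DualEval.

Definition dual_const (c : R) : dual := mk_dual c 0.

Lemma dual_const_zmod_morphism : zmod_morphism dual_const.
Proof. by move=> a b; rewrite /dual_const dualN dualD oppr0 addr0. Qed.
Lemma dual_const_monoid_morphism : monoid_morphism dual_const.
Proof. by split=> // a b; rewrite /dual_const dualM mulr0 mul0r addr0. Qed.

HB.instance Definition _ := GRing.isZmodMorphism.Build R dual dual_const
  dual_const_zmod_morphism.
HB.instance Definition _ := GRing.isMonoidMorphism.Build R dual dual_const
  dual_const_monoid_morphism.

Lemma mmap_dual (S : comNzRingType) (f : {rmorphism S -> R}) l
    (y y' : 'I_l -> R) (p : {mpoly S[l]}) :
  mmap (dual_const \o f) (fun j => mk_dual (y j) (y' j)) p =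
  mk_dual (mmap f y p) (\sum_j mmap f y p^`M(j) * y' j).
Proof.
elim/mpoly_alg_ind: p => [c|p q Dp Dq|j p Dp].
- by rewrite !mmapC big1 // => j _; rewrite mderivC mmap0 mul0r.
- rewrite !mmapD Dp Dq dualD -big_split; congr mk_dual; apply: eq_bigr => j _.
  by rewrite mderivD mmapD mulrDl.
rewrite !rmorphM /= Dp !mmapX !mmap1U dualM; congr mk_dual.
have {1}-> : y' j = \sum_i (j == i)%:R * y' i.
  by rewrite (bigD1 j) //= eqxx mul1r big1 ?addr0 // => i; rewrite eq_sym => /negPf ->; rewrite mul0r.
rewrite mulr_suml mulr_sumr -big_split; apply: eq_bigr => i _ /=.
rewrite mderivM mmapD !rmorphM /= mmapX mmap1U mderivX mnm1E.
case: (j =P i) => [->|_]; last by rewrite scale0r mmap0 !mul0r addr0 add0r mulrA.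
have -> : (U_(i) - U_(i))%MM = 0%MM by apply/mnmP => k; rewrite mnmBE subnn mnm0E.
by rewrite mpolyX0 scale1r rmorph1; ring.
Qed.

End DualNumbers.

Lemma mmap_dhomog_scale (S R : comNzRingType) (f : {rmorphism S -> R}) l d
    (p : {mpoly S[l]}) (h : 'I_l -> R) c :
  p \is d.-homog -> mmap f (fun j => c * h j) p = c ^+ d * mmap f h p.
Proof.
move=> /dhomogP hp; rewrite /mmap mulr_sumr [LHS]big_seq [RHS]big_seq.
apply: eq_bigr => k /hp /= <-; rewrite mulrCA; congr (_ * _).
rewrite /mmap1 mdegE expr_sum -big_split; apply: eq_bigr => i _.
by rewrite exprMn.
Qed.

Section FixedPoints.
Variables (A : comNzRingType) (m : nat).

(** On the locus of [param_fixed] each stage only rescales: stereographic projection by alpha,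
    [tangent_vector] by beta, [asymptotic_vector] by gamma. *)
Definition fixed_multiplier (y : nat -> A) : A :=
  let x := fun i => y (4 + i)%N in
  let alpha := - 2 * polar0 1 (nth 0 [:: 1; 0; 0; 1]) y in
  let beta := (alpha * y 1%N) ^+ 3 in
  let slope := 3 * alpha ^+ 2 * y 1%N * y 2%N *
    (alpha * (3 * y 1%N * x 4%N - 32 * y 2%N * (x 6%N - x 5%N))) in
  let gamma := - (beta ^+ 2 * slope) in
  - (alpha * gamma ^+ 4 * contact3 1 y x).

(* When z = (y 0, .., y 3) and x = (y 4, ..) satisfy the equations below, x is
   the residual point of its own line of triple contact at z. *)
Lemma param_fixed (y : nat -> A) i : let x := fun i => y (4 + i)%N in
  quad0 1 y = 0 -> contact1 1 y x = 0 -> contact2 1 y x = 0 -> quartic m 1 x = 0 ->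
  param m 1 y i = fixed_multiplier y * x i.
Proof.
move=> x y0 y1 y2 x0; rewrite /param /fixed_multiplier -/x.
set alpha := - 2 * _; set beta := (alpha * _) ^+ 3; set slope := 3 * _ * _ * _ * _.
have zE : quadric_point 1 y = fun j => alpha * y j.
  by apply/funext => j; rewrite /quadric_point y0 /alpha; ring.
have c1E : contact1 1 (fun j => alpha * y j) x = alpha ^+ 3 * contact1 1 y x.
  by rewrite /contact1; ring.
have vE : tangent_vector (fun j => alpha * y j) x = fun j => beta * x j.
  apply/funext => j; rewrite /tangent_vector; case: eqP => [->|//].
  apply/esym/subr0_eq; rewrite -[RHS](mulr0 (alpha ^+ 3)) -y1 -c1E /contact1 /beta; ring.
have c2E : contact2 1 (fun j => alpha * y j) (fun j => beta * x j) = 0.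
  transitivity (alpha ^+ 2 * beta ^+ 2 * contact2 1 y x); last by rewrite y2 mulr0.
  by rewrite /contact2 /polar0; ring.
set gamma := - (beta ^+ 2 * slope).
have aE : asymptotic_param 1 (fun j => alpha * y j) x = fun j => gamma * x j.
  apply/funext => j; rewrite /asymptotic_param vE /asymptotic_vector c2E mul0r add0r.
  by rewrite /contact2_slope /gamma /slope /x /=; ring.
rewrite zE aE /residual_point quartic_scale x0 mulr0 mul0r add0r.
rewrite (_ : contact3 _ _ _ = alpha * gamma ^+ 3 * contact3 1 y x); first ring.
by rewrite /contact3 /polar0 /quad0 /quad1 /quad2; ring.
Qed.

End FixedPoints.

Section BasePoint.
Variable m : nat.

(* At t = 1: a point z = (2 : 1 : -1 : 0) of the quadric surface, followed by a
   rational point x of the quartic lying on a line of triple contact at z. *)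
Definition base : nat -> rat := nth 0 [:: 2; 1; -1; 0; 9; 9; -7; 1; 0; 9; 13].

Lemma fixed_multiplier_base (y : nat -> rat) :
  (forall j, (j < 11 + m)%N -> y j = base j) -> fixed_multiplier y != 0.
Proof.
move=> yE; rewrite /fixed_multiplier; set alpha := - 2 * _.
have aE : alpha = 4 by rewrite /alpha /polar0 /= !yE //= /base /=; ring.
set slope := 3 * _ * _ * _ * _; have sE : slope = - (2 ^+ 13 * 3).
  by rewrite /slope aE !yE //= /base /=; ring.
set c3 := contact3 _ _ _; have cE : c3 = 32.
  by rewrite /c3 /contact3 /polar0 /quad0 /quad1 /quad2 /= !yE //= /base /=; ring.
have a0 : alpha != 0 by rewrite aE.
have s0 : slope != 0 by rewrite sE oppr_eq0 mulf_neq0 // expf_neq0.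
have c0 : c3 != 0 by rewrite cE.
have y1 : y 1%N != 0 by rewrite yE.
move: (y 1%N) y1 => r r0; clear -a0 s0 c0 r0; clearbody c3; clearbody slope.
clearbody alpha.
by rewrite !(oppr_eq0, mulf_eq0, expf_eq0, negb_or) /= a0 s0 c0 r0.
Qed.

Variables (Y : nat -> dual rat) (y' : nat -> rat).
Hypothesis YE : forall j, (j < 11 + m)%N -> Y j = mk_dual (base j) (y' j).

(* The linearization at the base point of the equations of param_fixed. *)
Hypotheses
  (y'_quad0 : y' 1%N - 3 * y' 2%N = 0)
  (y'_contact1 : 384 * y' 2%N + y' 8%N + 64 * y' 9%N - 64 * y' 4%N = 0)
  (y'_contact2 : 96 * (9 * y' 1%N - 21 * y' 2%N + y' 3%N + y' 5%N - 3 * y' 6%N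
        - 2 * y' 4%N) + 24 * (18 * y' 9%N + 26 * y' 10%N - 36 * y' 4%N)
      + 27 * y' 8%N - 672 * (y' 10%N - y' 9%N) + 384 * y' 6%N + 5376 * y' 2%N = 0)
  (y'_quartic : 592 * (9 * y' 5%N - 21 * y' 6%N + y' 7%N - 9 * y' 4%N)
      + 2916 * y' 9%N + 8788 * y' 10%N - 5832 * y' 4%N + 729 * y' 8%N
      - 10976 * (y' 10%N - y' 9%N) + 18816 * y' 6%N = 0)
  (y'_0 : y' 0%N = 0).

Let X i := Y (4 + i)%N.

Ltac dual_eval := repeat lazymatch goal with
  | |- _ + _ = _ => eapply dual_evalD
  | |- _ * _ = _ => eapply dual_evalM
  | |- - _ = _ => eapply dual_evalN
  | |- _ ^+ _ = _ => eapply dual_evalX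
  | |- _%:R = _ => exact: dual_nat
  | |- 1 = _ => exact: (erefl (mk_dual 1 0))
  | |- _ => by apply: YE
  end.

Ltac dual_compute k H :=
  eapply dual_eval0; [by dual_eval | |]; rewrite /base ?(addSn, add0n) /= ?y'_0;
  [ring | apply: etrans (_ : _ = k * _) (etrans (congr1 _ H) (mulr0 k)); ring].

Lemma base_quad0 : quad0 1 Y = 0.
Proof. rewrite /quad0; dual_compute (2 : rat) y'_quad0. Qed.

Lemma base_contact1 : contact1 1 Y X = 0.
Proof. rewrite /contact1 /X; dual_compute (1 : rat) y'_contact1. Qed.

Lemma base_contact2 : contact2 1 Y X = 0.
Proof. rewrite /contact2 /polar0 /X; dual_compute (1 : rat) y'_contact2. Qed.

Lemma base_quartic : quartic m 1 X = 0.
Proof.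
rewrite /quartic /residual (_ : tail4 m X = 0); last first.
  apply: big1 => i _; rewrite /X YE; last by rewrite !addnA ltn_add2l.
  have le11 : (11 <= 4 + (7 + i))%N by rewrite addnA leq_addr.
  rewrite /base nth_default; last exact: le11.
  by rewrite dualX (_ : 0 ^+ 4.-1 = 0) ?mulr0 ?mul0r ?expr0n.
rewrite addr0 /quad0 /quad1 /quad2 /X; dual_compute (1 : rat) y'_quartic.
Qed.

End BasePoint.

(** The linear system is triangular: with [y' 0] zero and [y' 1] tied to [y' 2], the pivots 384, 96
    and 592 determine [y' 2], [y' 3] and [y' 7]. The last is the x3-coordinate of the image, so all
    other image coordinates stay free. *)
Lemma base_direction (delta : nat -> rat) : exists y' : nat -> rat,
  [/\ y' 1%N - 3 * y' 2%N = 0,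
      384 * y' 2%N + y' 8%N + 64 * y' 9%N - 64 * y' 4%N = 0,
      96 * (9 * y' 1%N - 21 * y' 2%N + y' 3%N + y' 5%N - 3 * y' 6%N
          - 2 * y' 4%N) + 24 * (18 * y' 9%N + 26 * y' 10%N - 36 * y' 4%N)
        + 27 * y' 8%N - 672 * (y' 10%N - y' 9%N) + 384 * y' 6%N + 5376 * y' 2%N = 0,
      592 * (9 * y' 5%N - 21 * y' 6%N + y' 7%N - 9 * y' 4%N)
        + 2916 * y' 9%N + 8788 * y' 10%N - 5832 * y' 4%N + 729 * y' 8%N
        - 10976 * (y' 10%N - y' 9%N) + 18816 * y' 6%N = 0
    & y' 0%N = 0 /\ forall i, i != 3%N -> y' (4 + i)%N = delta i].
Proof.
have name (d : rat) : exists d', d = d' by exists d.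
have [d0 E0] := name (delta 0%N); have [d1 E1] := name (delta 1%N).
have [d2 E2] := name (delta 2%N); have [d4 E4] := name (delta 4%N).
have [d5 E5] := name (delta 5%N); have [d6 E6] := name (delta 6%N).
have solve (c b : rat) : c != 0 -> exists z, c * z + b = 0.
  by move=> c0; exists (- b / c); rewrite mulrC divfK // addNr.
have [z2 z2E] := solve 384 (d4 + 64 * d5 - 64 * d0) isT.
have [z3 z3E] := solve 96 (96 * (27 * z2 - 21 * z2 + d1 - 3 * d2 - 2 * d0)
  + 24 * (18 * d5 + 26 * d6 - 36 * d0) + 27 * d4 - 672 * (d6 - d5)
  + 384 * d2 + 5376 * z2) isT.
have [x3 x3E] := solve 592 (592 * (9 * d1 - 21 * d2 - 9 * d0) + 2916 * d5
  + 8788 * d6 - 5832 * d0 + 729 * d4 - 10976 * (d6 - d5) + 18816 * d2) isT.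
exists (fun j => nth (delta (j - 4)%N) [:: 0; 3 * z2; z2; z3; d0; d1; d2; x3; d4; d5; d6] j).
split.
- exact: subrr.
- by apply: etrans z2E; rewrite -[nth _ _ 2]/z2 -[nth _ _ 8]/d4 -[nth _ _ 9]/d5 -[nth _ _ 4]/d0; ring.
- apply: etrans z3E; rewrite -[nth _ _ 1]/(3 * z2) -[nth _ _ 2]/z2 -[nth _ _ 3]/z3 -[nth _ _ 5]/d1.
  by rewrite -[nth _ _ 6]/d2 -[nth _ _ 8]/d4 -[nth _ _ 9]/d5 -[nth _ _ 4]/d0 -[nth _ _ 10]/d6; ring.
- apply: etrans x3E; rewrite -[nth _ _ 7]/x3 -[nth _ _ 5]/d1.
  by rewrite -[nth _ _ 6]/d2 -[nth _ _ 8]/d4 -[nth _ _ 9]/d5 -[nth _ _ 4]/d0 -[nth _ _ 10]/d6; ring.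
clear -E0 E1 E2 E4 E5 E6; split=> // i.
by do 7?[case: i => [|i]] => //= _; rewrite ?(addSn, add0n) /= ?nth_nil ?(E0, E1, E2, E4, E5, E6).
Qed.

Section Jacobian.
Variable m : nat.

Let k := m.+4.+3.
Let l := m.+4.+4.+3.
Let G (i : 'I_k) : {mpoly {poly rat}[l]} := tnth (param_forms m 'X) i.
Let ev : {rmorphism {mpoly {poly rat}[l]} -> rat} :=
  mmap (horner_eval 1) (fun j : 'I_l => base j).

Let ev_dual (y' : nat -> rat) i :
  mmap (@dual_const rat \o horner_eval 1) (fun j : 'I_l => mk_dual (base j) (y' j)) (G i) =
  mk_dual (ev (G i)) (\sum_j ev (G i)^`M(j) * y' j).
Proof. exact: mmap_dual. Qed.

Lemma base_euler i : \sum_j ev (G i)^`M(j) * base j = 82 * ev (G i).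
Proof.
have := ev_dual base i.
(* Euler's relation: moving along [base] scales the point by 1 + eps, whose 82nd power is 1 + 82
   eps. *)
have -> : (fun j : 'I_l => mk_dual (base j) (base j)) =
    (fun j => mk_dual 1 1 * mk_dual (base j) ((fun=> 0) (j : nat))).
  by apply/funext => j; rewrite dualM; congr mk_dual; ring.
rewrite (mmap_dhomog_scale _ _ _ (homog_param_forms 'X i)) (ev_dual (fun=> 0) i) dualX dualM => /(congr1 snd) /= <-.
rewrite [X in _ * X]big1 => [|j _]; last by rewrite mulr0.
by rewrite !expr1n; ring.
Qed.

Lemma base_point_value : exists2 u : rat, u != 0 &
  forall i : 'I_k, ev (G i) = u * base (4 + i)%N.
Proof.
pose y j := base (@inord l.-1 j).
have yE j : (j < 11 + m)%N -> y j = base j by move=> lt_j; rewrite /y inordK.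
exists (fixed_multiplier y); first exact: fixed_multiplier_base yE.
move=> i; rewrite /ev /G /= mmap_param_forms /= /horner_eval hornerX -/y.
rewrite -[RHS](congr1 _ (yE (4 + i)%N _)); last by rewrite ltn_add2l.
apply: param_fixed.
- by rewrite /quad0 !yE // /base /=; ring.
- by rewrite /contact1 !yE // /base /=; ring.
- by rewrite /contact2 /polar0 !yE // /base /=; ring.
rewrite /quartic /residual (_ : tail4 m _ = 0).
  by rewrite /quad0 /quad1 /quad2 !yE // /base /=; ring.
apply: big1 => j _; rewrite yE; last by rewrite !addnA ltn_add2l.
have le11 : (11 <= 4 + (7 + j))%N by rewrite addnA leq_addr.
by rewrite /base nth_default ?expr0n //.
Qed.

(** [param_fixed] over the dual numbers shows that, along a direction tangent to its locus, the
    image is (x + eps x') times a dual number U. The variation of U contributes a multiple of x,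
    removed by moving along [base] with [base_euler]. *)
Lemma base_jacobian (delta : nat -> rat) : exists v : 'I_l -> rat,
  forall i : 'I_k, i != 3%N :> nat -> \sum_j ev (G i)^`M(j) * v j = delta i.
Proof.
have [y' [e0 e1 e2 e3 [e4 y'delta]]] := base_direction delta.
pose Y j := mk_dual (base (@inord l.-1 j)) (y' (@inord l.-1 j)).
have YE j : (j < 11 + m)%N -> Y j = mk_dual (base j) (y' j) by move=> lt_j; rewrite /Y inordK.
have [u u0 uE] := base_point_value.
have [U GE] : exists U, forall i : 'I_k,
    mk_dual (ev (G i)) (\sum_j ev (G i)^`M(j) * y' j) =
    U * mk_dual (base (4 + i)%N) (y' (4 + i)%N).
  exists (fixed_multiplier Y) => i; rewrite -ev_dual /G mmap_param_forms /= /horner_eval hornerX -/(Y _).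
  rewrite -YE; last by rewrite ltn_add2l.
  apply: param_fixed.
  - exact: base_quad0 YE e0 e4.
  - exact: base_contact1 YE e1 e4.
  - exact: base_contact2 YE e2 e4.
  - exact: base_quartic YE e3.
clear e0 e1 e2 e3 e4 YE; have U1 : U.1 = u.
  have /esym := congr1 fst (GE (@inord k.-1 0)); rewrite -[LHS]/(U.1 * _) -[RHS]/(ev _) uE.
  by apply: mulIf; rewrite inordK.
pose r := U.2 / (82 * u).
exists (fun j => u^-1 * (y' j - r * base j)) => i i3.
transitivity (u^-1 * (\sum_j ev (G i)^`M(j) * y' j - r * \sum_j ev (G i)^`M(j) * base j)).
  rewrite [r * _]mulr_sumr -sumrB mulr_sumr; apply: eq_bigr => j _; ring.
have -> : \sum_j ev (G i)^`M(j) * y' j = u * y' (4 + i)%N + U.2 * base (4 + i)%N.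
  have := congr1 snd (GE i); rewrite -[LHS]/(\sum_j _) => ->.
  by rewrite -U1.
by rewrite base_euler uE (y'delta _ i3) /r; field.
Qed.

End Jacobian.

Lemma map_mpoly_mderiv (R S : nzRingType) (f : {rmorphism R -> S}) n
    (p : {mpoly R[n]}) i : map_mpoly f p^`M(i) = (map_mpoly f p)^`M(i).
Proof.
by apply/mpolyP => k; rewrite mcoeff_map_mpoly !mcoeff_deriv mcoeff_map_mpoly raddfMn.
Qed.

Section AlgebraicIndependence.
Variable m : nat.

Let k := m.+4.+3.
Let l := m.+4.+4.+3.
Let G (i : 'I_k) : {mpoly {poly rat}[l]} := tnth (param_forms m 'X) i.
Let GK (i : 'I_k) : {mpoly Qt[l]} := tnth (param_forms m frac_t) i.
Let i3 : 'I_k := inord 3.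

Let GKE i : GK i = map_mpoly (@tofrac _) (G i).
Proof. by rewrite /GK /G map_param_forms. Qed.

(** Full rank at the base point with t = 1 spreads to Q(t): a square matrix of polynomials
    specializing to the identity has nonzero determinant. *)
Lemma jacobian_kernel (c : 'I_k -> {mpoly Qt[l]}) :
  c i3 = 0 -> (forall j, \sum_i c i * (GK i)^`M(j) = 0) -> forall i, c i = 0.
Proof.
move=> c3 cG; pose ev : {rmorphism {mpoly {poly rat}[l]} -> rat} :=
  mmap (horner_eval 1) (fun j : 'I_l => base j).
have i3E (i : 'I_k) : (i != 3%N :> nat) = (i != i3) by rewrite -val_eqE /= inordK.
have /choice[V VE] : forall i' : 'I_k, exists v : 'I_l -> rat,
    forall i : 'I_k, i != i3 -> \sum_j ev (G i)^`M(j) * v j = (i == i')%:R.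
  move=> i'; have [v vE] := base_jacobian m (fun i => (i == i' :> nat)%:R).
  by exists v => i; rewrite -i3E => /vE.
pose cst (a : rat) : {mpoly {poly rat}[l]} := (a%:P)%:MP.
(* The excluded coordinate x3 is padded by a row and a column of the identity to keep N square. *)
pose N := \matrix_(i, i') if (i == i3) || (i' == i3) then (i == i')%:R
  else \sum_j (G i)^`M(j) * cst (V i' j).
have evN : map_mx ev N = 1%:M.
  apply/matrixP => i i'; rewrite !mxE; case: ifPn => [_|]; first exact: rmorph_nat.
  rewrite negb_or => /andP[ni ni']; rewrite -(VE i' i ni) rmorph_sum.
  apply: eq_bigr => j _ /=; rewrite rmorphM /=; congr (_ * _).
  by rewrite /cst /= mmapC /= /horner_eval hornerC.
have detN : \det N != 0.
  apply/eqP => detN; have := det_map_mx ev N.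
  by rewrite evN det1 detN rmorph0 => /eqP; rewrite oner_eq0.
pose NK := map_mx (map_mpoly (@tofrac _)) N.
have detNK : \det NK != 0.
  rewrite det_map_mx; apply: contraNneq detN => d0; apply/eqP.
  by apply: (map_mpoly_inj (@tofrac_inj _)); rewrite rmorph0.
pose C := \row_i c i.
have CN : C *m NK = 0.
  apply/rowP => i'; rewrite !mxE; under eq_bigr => i _ do rewrite !mxE.
  have [->|ni'] := eqVneq i' i3.
    rewrite big1 // => i _; rewrite orbT rmorph_nat.
    by case: eqP => [->|_]; rewrite ?c3 ?mul0r ?mulr0.
  transitivity (\sum_i \sum_j c i * (GK i)^`M(j) * map_mpoly (@tofrac _) (cst (V i' j))).
    apply: eq_bigr => i _; have [->|ni] := eqVneq i i3.
      by rewrite c3 mul0r big1 // => j _; rewrite !mul0r.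
    rewrite orbF rmorph_sum mulr_sumr; apply: eq_bigr => j _.
    by rewrite rmorphM /= GKE -map_mpoly_mderiv mulrA.
  by rewrite exchange_big big1 // => j _; rewrite -mulr_suml cG mul0r.
have : C *m NK *m \adj NK = 0 by rewrite CN mul0mx.
rewrite -mulmxA mul_mx_adj mul_mx_scalar => /rowP C0 i.
have /eqP := C0 i; rewrite !mxE mulf_eq0 (negPf detNK) => /eqP.
by [].
Qed.

Lemma Qt_natr n : n.+1%:R != 0 :> Qt.
Proof.
rewrite -(rmorph_nat (@tofrac _)) tofrac_eq0 -(rmorph_nat polyC) polyC_eq0.
by rewrite pnatr_eq0.
Qed.

Lemma Qt_natr_mul n (c : Qt) : n.+1%:R * c = 0 -> c = 0.
Proof. by move/eqP; rewrite mulf_eq0 (negPf (Qt_natr n)) => /eqP. Qed.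

(* By the chain rule and jacobian_kernel, the partial derivatives of a relation
   between the coordinates other than x_3 are again such relations. *)
Lemma algebraic_independence (P : {mpoly Qt[k]}) :
  P^`M(i3) = 0 -> P \mPo param_forms m frac_t = 0 -> P = 0.
Proof.
pose Q (P : {mpoly Qt[k]}) := P^`M(i3) = 0 /\ P \mPo param_forms m frac_t = 0.
have stable (R : {mpoly Qt[k]}) i : Q R -> Q R^`M(i).
  move=> [R3 RG]; split; first by rewrite mderiv_comm R3 mderiv0.
  apply: (@jacobian_kernel (fun i => R^`M(i) \mPo param_forms m frac_t)) => [|j].
    by rewrite R3 comp_mpoly0.
  have := @mmap_derivation k Qt _ (@mpolyC l Qt) (tnth (param_forms m frac_t))
    (mderiv j) R (@mderivM _ _ j) (@mderivC _ _ j).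
  by rewrite -[mmap _ _ R]/(R \mPo _) RG /= mderiv0 => /esym.
have const c : Q c%:MP -> c = 0.
  by case=> _; rewrite comp_mpolyC => /eqP; rewrite mpolyC_eq0 => /eqP.
by move=> P3 PG; exact: (mderiv_stable_eq0 Qt_natr_mul stable const (conj P3 PG)).
Qed.

End AlgebraicIndependence.

(** * Dominance *)

Lemma clear_denominators_square (F : fieldType) (y z c n1 d1 n2 d2 : F) :
  d1 != 0 -> d2 != 0 -> y = n1 / d1 -> z = n2 / d2 -> y ^+ 2 = z ^+ 2 * c ->
  (n1 * d2) ^+ 2 = (n2 * d1) ^+ 2 * c.
Proof.
move=> d10 d20 yE zE yz.
have -> : n1 = y * d1 by rewrite yE divfK.
have -> : n2 = z * d2 by rewrite zE divfK.
transitivity (y ^+ 2 * (d1 * d2) ^+ 2); first ring.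
by rewrite yz; ring.
Qed.

(** Parity of degrees, c having degree one. *)
Lemma frac_nonsquare (c : {poly rat}) (y z : Qt) :
  size c = 2%N -> y ^+ 2 = z ^+ 2 * tofrac c -> z = 0.
Proof.
move=> sc yz; have [n1 [d1 d10 yE]] := fraction_numden y.
have [n2 [d2 d20 zE]] := fraction_numden z.
have d1F : tofrac d1 != 0 by rewrite tofrac_eq0.
have d2F : tofrac d2 != 0 by rewrite tofrac_eq0.
have E : (n1 * d2) ^+ 2 = (n2 * d1) ^+ 2 * c.
  apply: tofrac_inj; rewrite tofracM !tofracXn !tofracM.
  exact: clear_denominators_square d1F d2F yE zE yz.
rewrite zE; have [->|n20] := eqVneq n2 0; first by rewrite tofrac0 mul0r.
have n2d1 : n2 * d1 != 0 by rewrite mulf_neq0.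
have c0 : c != 0 by rewrite -size_poly_gt0 sc.
have /(congr1 (fun p : {poly rat} => size p)) := E.
rewrite [RHS]size_mul ?expf_neq0 // sc addn2 /=.
have := size_exp (n1 * d2) 2; have := size_exp (n2 * d1) 2.
have : (0 < size ((n2 * d1) ^+ 2 : {poly rat}))%N by rewrite size_poly_gt0 expf_neq0.
move: (size ((n1 * d2) ^+ 2 : {poly rat})%R) (size ((n2 * d1) ^+ 2 : {poly rat})%R) => s s'.
by move: (size (n1 * d2)%R).-1 (size (n2 * d1)%R).-1 => a b; lia.
Qed.

Lemma poly_nonsquare (a : {poly rat}) (P Q D : {poly Qt}) :
  size a = 2%N -> size D = 5%N -> lead_coef D = tofrac a ->
  P ^+ 2 = Q ^+ 2 * D -> Q = 0.
Proof.
move=> sa sD lD PQ; apply/eqP; rewrite -lead_coef_eq0; apply/eqP.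
apply: (@frac_nonsquare a (lead_coef P)) => //.
by rewrite -lD -!lead_coef_exp PQ lead_coefM.
Qed.

Lemma axis_identity (R : comNzRingType) (t c u0 u1 u2 u5 u6 : R) (X : {poly R}) :
  let al := u5 ^+ 2 - u0 ^+ 2 in let ga := u6 ^+ 2 - u0 ^+ 2 in
  (1 - t%:P) * ((u5%:P ^+ 2 - u0%:P ^+ 2 - 5 * X ^+ 2) ^+ 2
    + (u6%:P ^+ 2 - u0%:P ^+ 2 + 5 * X ^+ 2) ^+ 2)
  + t%:P * (u5%:P ^+ 4 + u6%:P ^+ 4 - 2 * u0%:P ^+ 4 - 50 * X ^+ 4
            + X * u1%:P ^+ 3 + 32 * (u6%:P - u5%:P) * u2%:P ^+ 3) + c%:P
  = (50 - 100 * t)%:P * X ^+ 4 + (((1 - t) * 10 * (ga - al))%:P * X ^+ 2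
    + (t * u1 ^+ 3)%:P * X
    + ((1 - t) * (al ^+ 2 + ga ^+ 2) + t * (u5 ^+ 4 + u6 ^+ 4 - 2 * u0 ^+ 4
       + 32 * (u6 - u5) * u2 ^+ 3) + c)%:P).
Proof. move=> al ga; rewrite /al /ga. ring. Qed.

Lemma axis_line_quad (F : idomainType) n (i a b d : 'I_n) (v : 'I_n -> F) (t : F) :
  a != i -> b != i -> d != i ->
  axis_line i v ('X_a ^+ 2 + 3 * 'X_b ^+ 2 - t%:MP ^+ 2 * 'X_d ^+ 2) =
  (v a ^+ 2 + 3 * v b ^+ 2 - t ^+ 2 * v d ^+ 2)%:P.
Proof.
move=> ai bi di; have xE j : j != i -> axis_line i v 'X_j = (v j)%:P.
  by move=> /negPf ji; rewrite /axis_line mmapX mmap1U ji mul0r addr0.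
have tE : axis_line i v t%:MP = t%:P by rewrite /axis_line mmapC.
transitivity (axis_line i v 'X_a ^+ 2 + 3 * axis_line i v 'X_b ^+ 2
  - axis_line i v t%:MP ^+ 2 * axis_line i v 'X_d ^+ 2).
  have morph (S T : comNzRingType) (f : {rmorphism S -> T}) x y z w :
      f (x ^+ 2 + 3 * y ^+ 2 - z ^+ 2 * w ^+ 2) =
      f x ^+ 2 + 3 * f y ^+ 2 - f z ^+ 2 * f w ^+ 2 by ring.
  exact: (morph _ _ (axis_line i v)).
by rewrite !xE // tE; ring.
Qed.

Section Nonsquares.
Variable m : nat.
Let k := m.+4.+3.
Let i4 : 'I_k := inord 4.

Definition base_quad : {mpoly Qt[k]} :=
  let x i : {mpoly Qt[k]} := 'X_(inord i) in
  x 1%N ^+ 2 + 3 * x 2%N ^+ 2 - frac_t%:MP ^+ 2 * x 0%N ^+ 2.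

Definition base_residual : {mpoly Qt[k]} :=
  residual m frac_t%:MP (fun i => 'X_(inord i)).

Lemma quartic_form_biquadratic :
  quartic_form m frac_t = ('X_(inord 3) ^+ 2 + base_quad) ^+ 2 + base_residual.
Proof. by rewrite /quartic_form /quartic /quad0 /base_quad /base_residual; ring. Qed.

(* On every line parallel to the b-axis both polynomials are quartic, and their
   leading coefficients +-50 (1 - 2 t) are not squares in Q(t). *)
Lemma axis_residual (v : 'I_k -> Qt) : v i4 = 0 ->
  exists r : {poly Qt}, (size r <= 4)%N /\
    axis_line i4 v base_residual = (50 - 100 * frac_t)%:P * 'X^4 + r.
Proof.
move=> v4; rewrite /base_residual (residual_morph (axis_line i4 v)) /= {1}/axis_line mmapC.
set x := _ \o _.
have xE (i : nat) : (i < 7)%N -> i != 4%N -> x i = (v (inord i))%:P.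
  move=> i7 i4n; rewrite /x /= /axis_line mmapX mmap1U -val_eqE /= !inordK //; last first.
    exact: leq_trans i7 _.
  by rewrite (negPf i4n) mul0r addr0.
have x4 : x 4%N = 'X.
  by rewrite /x /= /axis_line mmapX mmap1U eqxx v4 mul1r add0r.
have [c tail0] : exists c, tail4 m x = c%:P.
  exists (\sum_(i < m) v (inord (7 + i)) ^+ 4); rewrite rmorph_sum; apply: eq_bigr => i _.
  rewrite rmorphXn /= /x /= /axis_line mmapX mmap1U -val_eqE /= !inordK //.
    by rewrite mul0r addr0.
  exact: (leq_add (leqnn 7) (ltn_ord i)).
pose u i := v (inord i).
pose al := u 5%N ^+ 2 - u 0%N ^+ 2; pose ga := u 6%N ^+ 2 - u 0%N ^+ 2.
pose c2 := (1 - frac_t) * 10 * (ga - al); pose c1 := frac_t * u 1%N ^+ 3.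
pose c0 := (1 - frac_t) * (al ^+ 2 + ga ^+ 2) + frac_t * (u 5%N ^+ 4 + u 6%N ^+ 4
  - 2 * u 0%N ^+ 4 + 32 * (u 6%N - u 5%N) * u 2%N ^+ 3) + c.
exists (c2%:P * 'X^2 + c1%:P * 'X + c0%:P); split.
  rewrite -['X]expr1 -[c0%:P]mulr1 -(expr0 'X).
  have mono (a : Qt) j : (j < 4)%N -> (size (a%:P * 'X^j : {poly Qt})%R <= 4)%N.
    move=> j4; rewrite mul_polyC; apply: leq_trans (size_scale_leq _ _) _.
    by rewrite size_polyXn.
  by do 2!(apply: leq_trans (size_polyD _ _) _; rewrite geq_max !mono // andbT).
rewrite /residual /quad1 /quad2 tail0 x4 !xE //; exact: axis_identity.
Qed.

Lemma nonsquare_on_axis (D : {mpoly Qt[k]}) (a : {poly rat}) (P Q : {mpoly Qt[k]}) :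
  size a = 2%N ->
  (forall v, v i4 = 0 -> exists r : {poly Qt}, (size r <= 4)%N /\
    axis_line i4 v D = (tofrac a)%:P * 'X^4 + r) ->
  P ^+ 2 = Q ^+ 2 * D -> P = 0 /\ Q = 0.
Proof.
move=> sa lineD PQ.
have Q0 : Q = 0.
  apply: (meval_eq0 Qt_natr) => v.
  (* The point v is moved along the b-axis to b = 0; on the resulting line it has parameter
     [v i4]. *)
  pose v0 j := if j == i4 then 0 else v j.
  have [|r [sr Dr]] := lineD v0; first by rewrite /v0 eqxx.
  have a0 : tofrac a != 0 by rewrite tofrac_eq0 -size_poly_gt0 sa.
  have s4 : size ((tofrac a)%:P * 'X^4) = 5%N by rewrite mul_polyC size_scale ?size_polyXn.
  have s5 : size (axis_line i4 v0 D) = 5%N by rewrite Dr size_polyDl s4.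
  have l5 : lead_coef (axis_line i4 v0 D) = tofrac a.
    by rewrite Dr lead_coefDl ?s4 // mul_polyC lead_coefZ lead_coefXn mulr1.
  have PQv : axis_line i4 v0 P ^+ 2 = axis_line i4 v0 Q ^+ 2 * axis_line i4 v0 D.
    have lineX (S : {mpoly Qt[k]}) : axis_line i4 v0 (S ^+ 2) = axis_line i4 v0 S ^+ 2.
      exact: rmorphXn.
    apply: etrans (esym (lineX P)) _; apply: etrans (congr1 (axis_line i4 v0) PQ) _.
    apply: etrans (rmorphM (axis_line i4 v0) (Q ^+ 2) D) _.
    by congr (_ * _); exact: lineX.
  have := poly_nonsquare sa s5 l5 PQv.
  by move/(congr1 (horner^~ (v i4))); rewrite horner0 axis_line_through.
split=> //; apply/eqP; rewrite -sqrf_eq0 PQ Q0 expr2 !mul0r.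
exact: eqxx.
Qed.

Let lead_poly : {poly rat} := 50 - 100 * 'X.

Let lead_polyE : tofrac lead_poly = 50 - 100 * frac_t.
Proof. by rewrite /lead_poly rmorphB rmorphM /= !rmorph_nat. Qed.

Let size_lead_poly : size lead_poly = 2%N.
Proof.
rewrite /lead_poly addrC size_polyDl ?size_polyN -(rmorph_nat polyC) mul_polyC.
  by rewrite size_scale ?size_polyX // pnatr_eq0.
rewrite size_scale ?pnatr_eq0 // size_polyX -(rmorph_nat polyC) size_polyC.
by case: (_ != 0).
Qed.

Lemma nonsquare_R (P Q : {mpoly Qt[k]}) :
  P ^+ 2 = Q ^+ 2 * - base_residual -> P = 0 /\ Q = 0.
Proof.
apply: (@nonsquare_on_axis _ (- lead_poly)) => [|v v4]; first by rewrite size_polyN.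
have [r [sr rE]] := axis_residual v4; exists (- r); rewrite size_polyN; split=> //.
by rewrite [LHS]rmorphN /= rE opprD tofracN lead_polyE polyCN mulNr.
Qed.

Lemma nonsquare_C (P Q : {mpoly Qt[k]}) :
  P ^+ 2 = Q ^+ 2 * (base_quad ^+ 2 + base_residual) -> P = 0 /\ Q = 0.
Proof.
apply: (@nonsquare_on_axis _ lead_poly) => // v v4.
have [r [sr rE]] := axis_residual v4.
have [c cE] : exists c, axis_line i4 v base_quad = c%:P.
  eexists; apply: axis_line_quad; rewrite -val_eqE /= !inordK //.
exists (r + (c ^+ 2)%:P); split.
  apply: leq_trans (size_polyD _ _) _; rewrite geq_max sr /=.
  exact: leq_trans (size_polyC_leq1 _) _.
have morph (S T : comNzRingType) (f : {rmorphism S -> T}) x y :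
  f (x ^+ 2 + y) = f x ^+ 2 + f y by ring.
apply: etrans (morph _ _ (axis_line i4 v) base_quad base_residual) _ => /=.
by rewrite cE rE lead_polyE polyC_exp addrC addrA.
Qed.

End Nonsquares.

(* A root y of the biquadratic Y^4 + 2 A Y^2 + C, C = A^2 + R, has degree four
   over the subring when neither C nor - R is a square: taking norms from the
   extension generated by y^2 turns a relation of degree three into square
   relations for C and - R. *)
Section Biquadratic.
Variables (S : idomainType) (T : comNzRingType) (phi : {rmorphism S -> T}).
Variable sub : S -> Prop.
Hypotheses (sub1 : sub 1) (subB : forall p q, sub p -> sub q -> sub (p - q))
  (subM : forall p q, sub p -> sub q -> sub (p * q)).
Hypothesis phi_inj : forall p, sub p -> phi p = 0 -> p = 0.
Variables (A R : S) (y : T).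
Hypotheses (subA : sub A) (subR : sub R) (yP : (y ^+ 2 + phi A) ^+ 2 + phi R = 0).
Hypothesis C_nonsquare : forall p q, p ^+ 2 = q ^+ 2 * (A ^+ 2 + R) -> p = 0 /\ q = 0.
Hypothesis R_nonsquare : forall p q, p ^+ 2 = q ^+ 2 * - R -> p = 0 /\ q = 0.

Let subN p : sub p -> sub (- p).
Proof. by rewrite -sub0r => subp; apply: subB => //; rewrite -(subrr 1); apply: subB. Qed.
Let subD p q : sub p -> sub q -> sub (p + q).
Proof. by move=> subp subq; rewrite -[q]opprK; apply: subB => //; apply: subN. Qed.
Let subX p n : sub p -> sub (p ^+ n).
Proof. by move=> subp; elim: n => // n; rewrite exprS; apply: subM. Qed.
Let sub_nat n : sub n%:R.
Proof. by elim: n => [|n IH]; [rewrite mulr0n -(subrr 1); apply: subB | rewrite -natr1; apply: subD]. Qed.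

Ltac solve_sub := repeat first [assumption | apply: sub_nat | apply: (subD) | apply: (subM)
  | apply: (subN) | apply: (subX)].

Lemma sum_sq_R_eq0 p q : p ^+ 2 + q ^+ 2 * R = 0 -> p = 0 /\ q = 0.
Proof. by move=> pq; apply: R_nonsquare; apply: subr0_eq; rewrite -[RHS]pq; ring. Qed.

Lemma biquadratic_relation_eq0 r0 r1 r2 r3 : sub r0 -> sub r1 -> sub r2 -> sub r3 ->
  phi r0 + phi r1 * y + phi r2 * y ^+ 2 + phi r3 * y ^+ 3 = 0 ->
  [/\ r0 = 0, r1 = 0, r2 = 0 & r3 = 0].
Proof.
move=> s0 s1 s2 s3 rel; set C := A ^+ 2 + R.
have subC : sub C by rewrite /C; solve_sub.
(* With Y = y^2, c0 + c1 Y = (r0 + r2 Y)^2 - Y (r1 + r3 Y)^2 is the relation multiplied by its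
   conjugate under y -> - y. *)
pose c0 := r0 ^+ 2 - C * r2 ^+ 2 - (- (2 * C * r1 * r3) + 2 * A * C * r3 ^+ 2).
pose c1 := 2 * r0 * r2 - 2 * A * r2 ^+ 2
  - (r1 ^+ 2 - 4 * A * r1 * r3 + r3 ^+ 2 * (4 * A ^+ 2 - C)).
have cY : phi c0 + phi c1 * y ^+ 2 = 0.
  transitivity ((phi r0 + phi r2 * y ^+ 2) ^+ 2 - (phi r1 + phi r3 * y ^+ 2) ^+ 2 * y ^+ 2
    - ((y ^+ 2 + phi A) ^+ 2 + phi R) * (phi r2 ^+ 2 - 2 * phi r1 * phi r3
       - phi r3 ^+ 2 * (y ^+ 2 - 2 * phi A))).
    by rewrite /c0 /c1 /C; ring.
  transitivity ((phi r0 + phi r1 * y + phi r2 * y ^+ 2 + phi r3 * y ^+ 3) *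
    (phi r0 - phi r1 * y + phi r2 * y ^+ 2 - phi r3 * y ^+ 3)); last by rewrite rel mul0r.
  by rewrite yP; ring.
(* The norm for Y -> - 2 A - Y of c0 + c1 Y is (c0 - A c1)^2 + c1^2 R. *)
have [c10 c1E] : c0 - A * c1 = 0 /\ c1 = 0.
  apply: sum_sq_R_eq0.
  transitivity (c0 ^+ 2 - 2 * A * c0 * c1 + c1 ^+ 2 * C); first by rewrite /C; ring.
  apply: phi_inj; first by rewrite /c0 /c1; solve_sub.
  transitivity ((phi c0 + phi c1 * y ^+ 2) * (phi c0 - 2 * phi A * phi c1 - phi c1 * y ^+ 2)
    + phi c1 ^+ 2 * ((y ^+ 2 + phi A) ^+ 2 + phi R)); first by rewrite /C; ring.
  by rewrite cY yP mul0r mulr0 addr0.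
have c0E : c0 = 0 by move: c10; rewrite c1E mulr0 subr0.
(* Norms of both sides of (r0 + r2 Y)^2 = Y (r1 + r3 Y)^2, where Y has norm C. *)
have [Na Nb] : r0 ^+ 2 - 2 * A * r0 * r2 + r2 ^+ 2 * C = 0 /\
    r1 ^+ 2 - 2 * A * r1 * r3 + r3 ^+ 2 * C = 0.
  apply: C_nonsquare; rewrite -/C; apply: subr0_eq.
  pose s := - (2 * C * r1 * r3) + 2 * A * C * r3 ^+ 2.
  pose u := r1 ^+ 2 - 4 * A * r1 * r3 + r3 ^+ 2 * (4 * A ^+ 2 - C).
  transitivity ((c0 + s) ^+ 2 - 2 * A * (c0 + s) * (c1 + u) + (c1 + u) ^+ 2 * C
    - (s ^+ 2 - 2 * A * s * u + u ^+ 2 * C)).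
    by rewrite /c0 /c1 /s /u; ring.
  by rewrite c0E c1E; ring.
have [r02 r2E] : r0 - A * r2 = 0 /\ r2 = 0.
  by apply: sum_sq_R_eq0; apply: etrans Na; rewrite /C; ring.
have [r13 r3E] : r1 - A * r3 = 0 /\ r3 = 0.
  by apply: sum_sq_R_eq0; apply: etrans Nb; rewrite /C; ring.
by move: r02 r13; rewrite r2E r3E mulr0 !subr0.
Qed.

End Biquadratic.

Lemma biquadratic_morph (S T : comNzRingType) (phi : {rmorphism S -> T}) x A R q r0 r1 r2 r3 :
  phi ((x ^+ 2 + A) ^+ 2 + R) = 0 -> (phi x ^+ 2 + phi A) ^+ 2 + phi R = 0 /\
  phi (q * ((x ^+ 2 + A) ^+ 2 + R) + (r0 + r1 * x + r2 * x ^+ 2 + r3 * x ^+ 3)) =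
  phi r0 + phi r1 * phi x + phi r2 * phi x ^+ 2 + phi r3 * phi x ^+ 3.
Proof.
move=> f0; split; first by rewrite -[RHS]f0; ring.
by rewrite rmorphD rmorphM f0 mulr0 add0r; ring.
Qed.

Lemma biquadratic_division (S : comNzRingType) n (sub : {mpoly S[n]} -> Prop)
    (A R : {mpoly S[n]}) (i : 'I_n) :
  (forall c, sub c%:MP) -> (forall p q, sub p -> sub q -> sub (p - q)) ->
  (forall p q, sub p -> sub q -> sub (p * q)) -> (forall j, j != i -> sub 'X_j) ->
  sub A -> sub R ->
  forall h, exists r : 'I_4 -> {mpoly S[n]}, exists q : {mpoly S[n]}, (forall j, sub (r j)) /\
    h = q * (('X_i ^+ 2 + A) ^+ 2 + R)
      + (r 0 + r 1 * 'X_i + r 2 * 'X_i ^+ 2 + r 3 * 'X_i ^+ 3).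
Proof.
move=> subC subB subM subX subA subR.
have subN p : sub p -> sub (- p) by rewrite -sub0r => ?; apply: (subB) => //; rewrite -mpolyC0.
have subD p q : sub p -> sub q -> sub (p + q).
  by move=> ? ?; rewrite -[q]opprK; apply: (subB) => //; apply: subN.
elim/mpoly_alg_ind => [c|p q [r [d [sr ->]]] [r' [d' [sr' ->]]]|j p [r [d [sr ->]]]].
- exists (fun j => if j == 0 then c%:MP else 0%:MP), 0; split=> [j|]; first by case: ifP.
  by rewrite /= mpolyC0; ring.
- exists (fun j => r j + r' j), (d + d'); split=> [j|]; first exact: subD.
  ring.
have [->|ji] := eqVneq j i; last first.
  exists (fun k => 'X_j * r k), ('X_j * d); split=> [k|]; last ring.
  by apply: (subM) => //; apply: subX.
(* Multiplication by X_i shifts the remainder, and X_i^4 is replaced by - 2 A X_i^2 - (A^2 + R). *)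
exists (fun k : 'I_4 => nth 0 [:: - (r 3 * (A ^+ 2 + R)); r 0; r 1 - 2 * A * r 3; r 2] k).
exists ('X_i * d + r 3); split=> [[k lt_k]|]; last by rewrite /=; ring.
have s2 : sub 2 by rewrite -[2](rmorph_nat (@mpolyC n S)); apply: subC.
case: k lt_k => [|[|[|[|//]]]] lt_k /=; try exact: sr.
  by apply: (subN); apply: (subM) => //; apply: (subD) => //; apply: (subM).
by apply: (subB) => //; do 2?apply: (subM) => //.
Qed.

Section GenericPoint.
Variables (F L : comNzRingType) (k l : nat) (iota : {rmorphism F -> L}).
Variables (tau : {rmorphism {mpoly F[l]} -> L}) (g : k.-tuple {mpoly F[l]}).
Hypothesis tauC : forall c, tau c%:MP = iota c.

Lemma meval_comp_mpoly (v : 'I_k -> L) : (forall i, v i = tau (tnth g i)) ->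
  forall p, (map_mpoly iota p).@[v] = tau (p \mPo g).
Proof.
move=> vE; elim/mpoly_alg_ind => [c|p q Ep Eq|j p Ep].
- by rewrite map_mpolyC mevalC comp_mpolyC tauC.
- by rewrite rmorphD mevalD Ep Eq comp_mpolyD rmorphD.
rewrite rmorphM mevalM Ep /= map_mpolyX mevalXU vE [RHS](rmorphM (tau \o comp_mpoly g)) /=.
by rewrite comp_mpolyXU -tnth_nth.
Qed.

End GenericPoint.

(** The hypothesis is applied to the generic point, whose coordinates are the variables in the field
    of rational functions. *)
Lemma vanishing_on_image (F : fieldType) k l (g : k.-tuple {mpoly F[l]}) (h : {mpoly F[k]}) :
  (exists i, tnth g i != 0) ->
  (forall (L : fieldType) (iota : {rmorphism F -> L}) (y : 'rV[L]_l),
    eval_forms iota g y != 0 -> vanishes_at iota h (eval_forms iota g y)) ->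
  h \mPo g = 0.
Proof.
move=> [i0 gi0] H; pose L : fieldType := {fraction {mpoly F[l]}}.
pose tau : {rmorphism {mpoly F[l]} -> L} := @tofrac _.
pose iota : {rmorphism F -> L} := tau \o @mpolyC l F.
have tauC c : tau c%:MP = iota c by [].
pose y : 'rV[L]_l := \row_j tau 'X_j.
have gE i : eval_forms iota g y 0 i = tau (tnth g i).
  rewrite mxE (meval_comp_mpoly (g := [tuple 'X_j | j < l]) tauC) => [|j].
    by rewrite comp_mpoly_id.
  by rewrite mxE tnth_mktuple.
have hE := meval_comp_mpoly tauC gE h.
have tau_inj : injective tau by exact: tofrac_inj.
apply: (tau_inj); rewrite rmorph0 -hE; apply: (H L iota y).
apply: contraNneq gi0 => g0; apply/eqP; apply: (tau_inj).
by rewrite -gE g0 mxE rmorph0.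
Qed.

Section FreeOfX3.
Variables (R : comNzRingType) (m : nat) (t : R).
Let i3 : 'I_m.+4.+3 := inord 3.
(** Not involving x3, expressed by a derivative because this is visibly stable under the other
    partial derivatives. *)
Let free (p : {mpoly R[m.+4.+3]}) := p^`M(i3) = 0.

Lemma free_const c : free c%:MP. Proof. exact: mderivC. Qed.
Lemma freeB p q : free p -> free q -> free (p - q).
Proof. by rewrite /free mderivB => -> ->; rewrite subr0. Qed.
Lemma freeM p q : free p -> free q -> free (p * q).
Proof. by rewrite /free mderivM => -> ->; rewrite mul0r mulr0 addr0. Qed.
Lemma free_var j : j != i3 -> free 'X_j.
Proof. by move=> /negPf ji; rewrite /free mderivX mnm1E ji scale0r. Qed.

Let freeN p : free p -> free (- p).
Proof. by rewrite /free mderivN => ->; rewrite oppr0. Qed.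
Let freeD p q : free p -> free q -> free (p + q).
Proof. by rewrite /free mderivD => -> ->; rewrite addr0. Qed.
Let freeX p n : free p -> free (p ^+ n).
Proof. by move=> hp; elim: n => [|n IH]; [exact: free_const | rewrite exprS; exact: freeM]. Qed.
Let free_nat n : free n%:R.
Proof. by rewrite -(rmorph_nat (@mpolyC _ R)); exact: free_const. Qed.

Lemma free_inord i : (i < 7 + m)%N -> i != 3%N -> free 'X_(inord i).
Proof. by move=> im i3n; apply: free_var; rewrite -val_eqE /= !inordK. Qed.

Ltac solve_free := repeat first [apply: free_nat | apply: free_const
  | apply: (freeD) | apply: (freeN) | apply: (freeM) | apply: (freeX)
  | by apply: free_inord].

Lemma free_base_quad : free ('X_(inord 1) ^+ 2 + 3 * 'X_(inord 2) ^+ 2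
  - t%:MP ^+ 2 * 'X_(inord 0) ^+ 2).
Proof. solve_free. Qed.

Lemma free_residual : free (residual m t%:MP (fun i => 'X_(inord i))).
Proof.
have free_tail : free (tail4 m (fun i => 'X_(inord i) : {mpoly R[m.+4.+3]})).
  rewrite /tail4; elim/big_ind: _ => [||i _]; [exact: mderiv0 | exact: freeD |].
  by apply: freeX; apply: free_inord; rewrite ?ltn_add2l.
rewrite /residual /quad1 /quad2; apply: freeD free_tail.
by solve_free; exact: (free_nat 1).
Qed.

End FreeOfX3.

Lemma param_forms_neq0 m : tnth (param_forms m frac_t) (inord 0) != 0.
Proof.
have [u u0 uE] := base_point_value m; apply/eqP => G0.
have := uE (inord 0); rewrite inordK // (_ : tnth _ _ = 0) ?rmorph0.
  by move/esym/eqP; rewrite mulf_eq0 (negPf u0).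
by apply: (map_mpoly_inj (@tofrac_inj _)); rewrite map_param_forms rmorph0.
Qed.

(** A form h vanishing on the image is divided by f as a polynomial in x3. The remainder is a
    relation of degree at most three for x3 over the other, independent coordinates, so it is zero
    and f divides h. *)
Lemma param_forms_dominant m :
  is_dominant_to (quartic_form m frac_t) (param_forms m frac_t).
Proof.
move=> e h _ H L iota x _ fx.
have hG : h \mPo param_forms m frac_t = 0.
  by apply: vanishing_on_image H; exists (inord 0); exact: param_forms_neq0.
pose i3 : 'I_m.+4.+3 := inord 3.
pose A := base_quad m; pose R := base_residual m.
have [r [q [r_free hE]]] := @biquadratic_division _ _ (fun p => p^`M(i3) = 0) A R i3
  (@free_const _ m) (@freeB _ m) (@freeM _ m) (@free_var _ m)
  (free_base_quad m frac_t) (free_residual m frac_t) h.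
have fE := quartic_form_biquadratic m.
pose phi : {rmorphism {mpoly Qt[m.+4.+3]} -> {mpoly Qt[m.+4.+4.+3]}} :=
  comp_mpoly (param_forms m frac_t).
have f0 : phi (('X_i3 ^+ 2 + A) ^+ 2 + R) = 0.
  by rewrite -fE; exact: quartic_form_param_forms.
have [yP rel] := biquadratic_morph q (r 0) (r 1) (r 2) (r 3) f0.
rewrite -hE in rel; have {}rel := etrans (esym rel) hG.
have [r0 r1 r2 r3] := @biquadratic_relation_eq0 _ _ phi (fun p => p^`M(i3) = 0)
  (@free_const _ m 1) (@freeB _ m) (@freeM _ m) (@algebraic_independence m) A R (phi 'X_i3)
  (free_base_quad m frac_t) (free_residual m frac_t) yP (@nonsquare_C m) (@nonsquare_R m) _ _ _ _
  (r_free 0) (r_free 1) (r_free 2) (r_free 3) rel.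
have {}hE : h = q * quartic_form m frac_t.
  by rewrite fE hE r0 r1 r2 r3 !mul0r !addr0.
by rewrite /vanishes_at hE rmorphM mevalM (fx : _ = 0) mulr0.
Qed.

Lemma quartic_form_neq0 m : quartic_form m frac_t != 0.
Proof.
have at_e (F : comNzRingType) (t : F) : quartic m t (fun i => (i == 5%N)%:R) = 1.
  rewrite /quartic /residual (_ : tail4 m _ = 0).
    by rewrite /quad0 /quad1 /quad2 /=; ring.
  by apply: big1 => i _; rewrite expr0n.
pose e i : Qt := (i == 5%N)%:R.
have fe := @meval_quartic_form _ m frac_t (fun i => e i).
apply/eqP => f0; move: fe; rewrite f0 meval0 -(quartic_inord m frac_t e) (at_e Qt).
by move/esym/eqP; rewrite oner_eq0.
Qed.

Theorem mainTheorem4 (n : nat) (hn : (5 <= n)%N) :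
  exists H : {mpoly Qt[n.+2]},
    [/\ is_hypersurface 4 H,
        smooth_hypersurface H,
        unirational_hypersurface H
      & infinite_set (R_classes H)].
Proof.
(* With n = m + 5 there are m + 7 coordinates, the last m forming the tail. *)
rewrite -(subnKC hn); move: (n - 5)%N => m {n hn}.
exists (quartic_form m frac_t); split.
- by split; [exact: quartic_form_neq0 | exact: homog_quartic_form].
- exact: smooth_quartic_form.
- exists m.+4.+4.+2, (param_forms m frac_t); split; last exact: param_forms_dominant.
  split; first by exists 82%N; exact: homog_param_forms.
    by exists (inord 0); exact: param_forms_neq0.
  exact: quartic_form_param_forms.
- exact: infinite_R_classes.
Qed.
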